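(* Let $\mathbf{Y}$ be the $n\times p$ data matrix whose rows are $n$ independent samples from $\mathrm{N}(0,\boldsymbol{\Omega}^{-1})$ given the concentration matrix $\boldsymbol{\Omega}$, let $\mathbf{S}=\mathbf{Y}'\mathbf{Y}$, and let $(\boldsymbol{\Omega},\mathbf{Z})$ have the hierarchical spike and slab prior defined in the context with $\mathbf{A}=\boldsymbol{\Omega}$. Let $\mathbf{V}=(v_{z_{ij}}^2)$ be the $p\times p$ symmetric matrix with zeros on the diagonal and $(v_{z_{ij}}^2)_{i<j}$ in the upper diagonal entries. Focusing on the last column and row, partition $$\boldsymbol{\Omega}=\begin{pmatrix}\boldsymbol{\Omega}_{11}&\boldsymbol{\omega}_{12}\\ \boldsymbol{\omega}_{12}'&\omega_{22}\end{pmatrix},\qquad \mathbf{S}=\begin{pmatrix}\mathbf{S}_{11}&\mathbf{s}_{12}\\ \mathbf{s}_{12}'&s_{22}\end{pmatrix},\qquad \mathbf{V}=\begin{pmatrix}\mathbf{V}_{11}&\mathbf{v}_{12}\\ \mathbf{v}_{12}'&0\end{pmatrix},$$ where the upper-left blocks are $(p-1)\times(p-1)$. Consider the change of variables $(\boldsymbol{\omega}_{12},\omega_{22})\mapsto(\mathbf{u},v)$ with $\mathbf{u}=\boldsymbol{\omega}_{12}$ and $v=\omega_{22}-\boldsymbol{\omega}_{12}'\boldsymbol{\Omega}_{11}^{-1}\boldsymbol{\omega}_{12}$. Then the full conditional distributions (of $\mathbf{u}$ given $\mathbf{Y},\mathbf{Z},\boldsymbol{\Omega}_{11},v$, and of $v$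 given $\mathbf{Y},\mathbf{Z},\boldsymbol{\Omega}_{11},\mathbf{u}$) are $$(\mathbf{u}\mid -)\sim \mathrm{N}(-\mathbf{C}\mathbf{s}_{12},\mathbf{C}),\qquad (v\mid -)\sim \mathrm{Ga}\Big(\frac n2+1,\ \frac{s_{22}+\lambda}{2}\Big),$$ where $\mathbf{C}=\{(s_{22}+\lambda)\boldsymbol{\Omega}_{11}^{-1}+\mathrm{diag}(\mathbf{v}_{12}^{-1})\}^{-1}$.
   Context: Let $M^+$ denote the cone of $p\times p$ symmetric positive definite real matrices. Parameters: $v_0>0$, $v_1>0$, $\lambda>0$, $\pi\in(0,1)$, collected as $\theta=\{v_0,v_1,\pi,\lambda\}$. The binary latent variables are $\mathbf{Z}=(z_{ij})_{i<j}\in\{0,1\}^{p(p-1)/2}$, and $v_{z_{ij}}=v_0$ if $z_{ij}=0$, $v_{z_{ij}}=v_1$ if $z_{ij}=1$. The hierarchical prior for a random matrix $\mathbf{A}=(a_{ij})\in M^+$ and $\mathbf{Z}$ is $$p(\mathbf{A}\mid\mathbf{Z},\theta)=\{C(\mathbf{Z},v_0,v_1,\lambda)\}^{-1}\prod_{i<j}\mathrm{N}(a_{ij}\mid 0,v_{z_{ij}}^2)\prod_i \mathrm{Exp}(a_{ii}\mid \lambda/2)\,1_{\{\mathbf{A}\in M^+\}},$$ $$p(\mathbf{Z}\mid\theta)=\{C(\theta)\}^{-1}C(\mathbf{Z},v_0,v_1,\lambda)\prod_{i<j}\pi^{z_{ij}}(1-\pi)^{1-z_{ij}},$$ where $\mathrm{N}(a\mid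 0,v^2)$ is the normal density with mean $0$ and variance $v^2$ at $a$, $\mathrm{Exp}(a\mid r)=r e^{-ra}1_{a>0}$, and $C(\mathbf{Z},v_0,v_1,\lambda)$, $C(\theta)$ are normalizing constants. Densities of $\mathbf{A}$ are with respect to Lebesgue measure on the entries $(a_{ij})_{i\le j}$. The data $\mathbf{Y}$ depend on $(\mathbf{A},\mathbf{Z})$ only through $\mathbf{A}$. $\mathrm{N}(\boldsymbol{\mu},\mathbf{C})$ is the multivariate normal distribution with mean $\boldsymbol{\mu}$ and covariance $\mathbf{C}$. $\mathrm{Ga}(\alpha,\beta)$ is the gamma distribution with shape $\alpha$ and rate $\beta$, i.e. density proportional to $x^{\alpha-1}e^{-\beta x}$ on $x>0$. The vector $\mathbf{v}_{12}^{-1}$ is the entrywise reciprocal of $\mathbf{v}_{12}$ (whose entries are the variances $v_{z_{ip}}^2$, $i=1,\dots,p-1$), and $\mathrm{diag}(\cdot)$ is the diagonal matrix with the given diagonal. The notation $(\cdot\mid -)$ means conditional on the data and all other variables. *)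

(* Defs.v *)
From HB Require Import structures.
From mathcomp Require Import all_boot all_order all_algebra.
From mathcomp Require Import all_classical all_reals all_analysis.

Set Implicit Arguments.
Unset Strict Implicit.
Unset Printing Implicit Defensive.

Import Order.TTheory GRing.Theory Num.Theory.
Import numFieldNormedType.Exports.

Local Open Scope classical_set_scope.
Local Open Scope ring_scope.

Definition mx_display : measure_display -> measure_display.
Proof. exact. Qed.

Section measurable_matrix.
Context {d} {T : measurableType d}.
Variables m n : nat.

Definition mx_measurable : set (set 'M[T]_(m, n)) :=
  <<s \bigcup_(ij in [set: 'I_m * 'I_n])
        preimage_set_system setT (fun M : 'M[T]_(m, n) => M ij.1 ij.2)
          measurable >>.

Let mx_measurable0 : mx_measurable set0.
Proof. exact: sigma_algebra0. Qed.

Let mx_measurableC A : mx_measurable A -> mx_measurable (~` A).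
Proof. exact: sigma_algebraC. Qed.

Let mx_measurable_bigcup (F : (set 'M[T]_(m, n))^nat) :
  (forall i, mx_measurable (F i)) -> mx_measurable (\bigcup_i (F i)).
Proof. exact: sigma_algebra_bigcup. Qed.

HB.instance Definition _ := @isMeasurable.Build (mx_display d) 'M[T]_(m, n)
  mx_measurable mx_measurable0 mx_measurableC mx_measurable_bigcup.

End measurable_matrix.

Lemma measurable_fun_mx d1 d2 (T1 : measurableType d1) (T2 : measurableType d2)
    m n (f : T1 -> 'M[T2]_(m, n)) :
  (forall i j, measurable_fun [set: T1] (fun x => f x i j)) ->
  measurable_fun [set: T1] f.
Proof.
move=> mf; apply: measurability => // _ [_ [[i j] _ [A mA <-]] <-].
by rewrite setTI; apply: (mf i j).
Qed.

Section lebesgue_tuple.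
Context {R : realType}.

Section cons.
Context {n : nat}.
Variable mu : {sigma_finite_measure set (n.-tuple R) -> \bar R}.

Definition tcons (x : measurableTypeR R * n.-tuple R) : (n.+1).-tuple R :=
  [tuple of x.1 :: x.2].

Let measurable_tcons : measurable_fun [set: _] tcons.
Proof. exact: measurable_cons. Qed.

Let prod_mu := (@lebesgue_measure R \x mu)%E.

Definition cons_measure : set ((n.+1).-tuple R) -> \bar R :=
  pushforward prod_mu tcons.

Let cons_measure0 : cons_measure set0 = 0%E.
Proof. exact: measure0. Qed.

Let cons_measure_ge0 A : (0 <= cons_measure A)%E.
Proof. exact: measure_ge0. Qed.

Let cons_measure_sigma_additive : semi_sigma_additive cons_measure.
Proof. exact: measure_semi_sigma_additive. Qed.

HB.instance Definition _ := isMeasure.Build _ _ _ cons_measure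
  cons_measure0 cons_measure_ge0 cons_measure_sigma_additive.

Let cons_measure_sigma_finite : sigma_finite setT cons_measure.
Proof.
have /sigma_finiteP[F [TF ndF Foo]] := sigma_finiteT (@lebesgue_measure R).
have /sigma_finiteP[G [TG ndG Goo]] := sigma_finiteT mu.
pose uncons (t : (n.+1).-tuple R) : measurableTypeR R * n.-tuple R :=
  (thead t, [tuple of behead t]).
have muncons : measurable_fun [set: _] uncons.
  apply: measurable_fun_pair; first exact: measurable_tnth.
  exact: measurable_behead.
have unconsK : uncons \o tcons = id.
  by apply/funext => -[x t]; congr pair; exact/val_inj.
exists (fun k => uncons @^-1` (F k `*` G k)).
  rewrite -preimage_bigcup -[LHS](preimage_setT uncons); congr (_ @^-1` _).
  rewrite -setXTT TF TG predeqE => -[x y]; split.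
    move=> [/= [a _ Fx] [b _ Gy]]; exists (maxn a b) => //; split.
    - by move: x Fx; exact/subsetPset/ndF/leq_maxl.
    - by move: y Gy; exact/subsetPset/ndG/leq_maxr.
  by move=> [a _ []/= ? ?]; split; exists a.
move=> k; have [mF Fk] := Foo k; have [mG Gk] := Goo k; split.
  by rewrite -[X in measurable X]setTI; apply: muncons => //; exact: measurableX.
rewrite /cons_measure /pushforward -comp_preimage unconsK preimage_id.
by rewrite [ltLHS]product_measure1E// lte_mul_pinfty// ge0_fin_numE.
Qed.

HB.instance Definition _ := Measure_isSigmaFinite.Build _ _ _ cons_measure
  cons_measure_sigma_finite.

End cons.


Fixpoint lebesgue_tuple n : {sigma_finite_measure set (n.-tuple R) -> \bar R} :=
  if n is n'.+1 then cons_measure (lebesgue_tuple n')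
  else \d_ ([tuple] : 0.-tuple R).

End lebesgue_tuple.

Arguments lebesgue_tuple R n : clear implicits.

Section lebesgue_matrix.
Context {R : realType}.

Definition mx_of_tuple m n (t : (m * n).-tuple R) : 'M[R]_(m, n) :=
  \matrix_(i, j) tnth t (mxvec_index i j).

(* Symmetric matrix with the given upper triangular entries, listed column by
   column: a_00, a_01, a_11, a_02, a_12, a_22, etc.; for i <= j there are
   j (j + 1) / 2 entries before column j. *)
Definition sym_of_tuple p (t : 'C(p.+1, 2).-tuple R) : 'M[R]_p :=
  \matrix_(i, j) t`_('C((maxn i j).+1, 2) + minn i j).

Definition lebesgue_mx m n : set 'M[R]_(m, n) -> \bar R :=
  pushforward (lebesgue_tuple R (m * n)) (@mx_of_tuple m n).

(* Lebesgue measure on the entries (a_ij)_{i <= j} of a symmetric matrix. *)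
Definition lebesgue_sym p : set 'M[R]_p -> \bar R :=
  pushforward (lebesgue_tuple R 'C(p.+1, 2)) (@sym_of_tuple p).

Let measurable_mx_of_tuple m n : measurable_fun [set: _] (@mx_of_tuple m n).
Proof.
apply: measurable_fun_mx => i j.
rewrite (_ : (fun _ => _) = (@tnth _ R ^~ (mxvec_index i j))).
  exact: measurable_tnth.
by apply/funext => t; rewrite mxE.
Qed.

Let measurable_sym_of_tuple p : measurable_fun [set: _] (@sym_of_tuple p).
Proof.
apply: measurable_fun_mx => i j.
have [k|k] := ltnP ('C((maxn i j).+1, 2) + minn i j) 'C(p.+1, 2).
  rewrite (_ : (fun _ => _) = (@tnth _ R ^~ (Ordinal k))).
    exact: measurable_tnth.
  by apply/funext => t; rewrite mxE (tnth_nth 0).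
rewrite (_ : (fun _ => _) = cst 0); first exact: measurable_cst.
by apply/funext => t; rewrite mxE nth_default ?size_tuple.
Qed.

Section measure_instances.
Variables m n : nat.

Let mmx := @measurable_mx_of_tuple m n.
Let msym := @measurable_sym_of_tuple n.

Let lebesgue_mx0 : @lebesgue_mx m n set0 = 0%E.
Proof. exact: measure0. Qed.

Let lebesgue_mx_ge0 A : (0 <= @lebesgue_mx m n A)%E.
Proof. exact: measure_ge0. Qed.

Let lebesgue_mx_sigma_additive : semi_sigma_additive (@lebesgue_mx m n).
Proof. exact: measure_semi_sigma_additive. Qed.

HB.instance Definition _ := isMeasure.Build _ _ _ (@lebesgue_mx m n)
  lebesgue_mx0 lebesgue_mx_ge0 lebesgue_mx_sigma_additive.

Let lebesgue_sym0 : @lebesgue_sym n set0 = 0%E.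
Proof. exact: measure0. Qed.

Let lebesgue_sym_ge0 A : (0 <= @lebesgue_sym n A)%E.
Proof. exact: measure_ge0. Qed.

Let lebesgue_sym_sigma_additive : semi_sigma_additive (@lebesgue_sym n).
Proof. exact: measure_semi_sigma_additive. Qed.

HB.instance Definition _ := isMeasure.Build _ _ _ (@lebesgue_sym n)
  lebesgue_sym0 lebesgue_sym_ge0 lebesgue_sym_sigma_additive.

End measure_instances.
End lebesgue_matrix.

Arguments lebesgue_mx R m n : clear implicits.
Arguments lebesgue_sym R p : clear implicits.

Section distributions.
Context {R : realType}.

Definition mvn_pdf d (mu : 'cV[R]_d) (C : 'M[R]_d) (x : 'cV[R]_d) : R :=
  (Num.sqrt ((2 * pi) ^+ d * \det C))^-1 *
  expR (- ((x - mu)^T *m invmx C *m (x - mu)) 0 0 / 2).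

Definition mvn d (mu : 'cV[R]_d) (C : 'M[R]_d) (A : set 'cV[R]_d) : \bar R :=
  \int[lebesgue_mx R d 1]_(x in A) (mvn_pdf mu C x)%:E.

Definition gamma_fun (a : R) : R :=
  fine (\int[lebesgue_measure]_(t in `]0, +oo[) (t `^ (a - 1) * expR (- t))%:E).

Definition gamma_pdf (a b x : R) : R :=
  if 0 < x then b `^ a / gamma_fun a * x `^ (a - 1) * expR (- (b * x)) else 0.

Definition gamma_dist (a b : R) (A : set R) : \bar R :=
  \int[lebesgue_measure]_(x in A) (gamma_pdf a b x)%:E.

End distributions.

Section conditional_distribution.
Context {d dX dG} {T : measurableType d} {U : measurableType dX}
  {W : measurableType dG} {R : realType}.
Variables (P : probability T R) (X : T -> U) (G : T -> W).

Definition regular_cond_dist (K : R.-pker W ~> U) :=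
  forall A B, measurable A -> measurable B ->
  P (X @^-1` A `&` G @^-1` B) = (\int[P]_(t in G @^-1` B) K (G t) A)%E.

(* [L t] is the law of [X] given [G = G t]; since it is only prescribed
   almost surely, it need not be a probability measure for every [t]. *)
Definition cond_distributed (L : T -> set U -> \bar R) :=
  [/\ measurable_fun [set: T] X, measurable_fun [set: T] G &
   exists2 K : R.-pker W ~> U, regular_cond_dist K &
     {ae P, forall t, forall A, measurable A -> K (G t) A = L t A}].

End conditional_distribution.

Section spike_slab.
Context {R : realType}.

Definition posdef p : set 'M[R]_p :=
  [set A | A^T = A /\
     forall x : 'cV[R]_p, x != 0 -> 0 < (x^T *m A *m x) 0 0].

(* The indicators z_ij, i < j, are listed column by column: z_01, z_02, z_12,
   etc.; there are j (j - 1) / 2 of them before column j. *)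
Definition zentry p (z : 'C(p, 2).-tuple bool) (i j : nat) : bool :=
  nth false z ('C(j, 2) + i).

Variables v0 v1 lambda prob : R.

(* Standard deviation of an off-diagonal entry; this, not the variance, is the
   second parameter of [normal_pdf]. *)
Definition sd (b : bool) : R := if b then v1 else v0.

Definition Vmx p (z : 'C(p, 2).-tuple bool) : 'M[R]_p :=
  \matrix_(i, j)
    if i == j then 0 else sd (zentry z (minn i j) (maxn i j)) ^+ 2.

Definition prior_unnorm p (z : 'C(p, 2).-tuple bool) (A : 'M[R]_p) : R :=
  (\prod_(i < p) \prod_(j < p | (i < j)%N)
     normal_pdf 0 (sd (zentry z i j)) (A i j)) *
  (\prod_(i < p) exponential_pdf (lambda / 2) (A i i)) *
  \1_(@posdef p) A.

Definition prior_const p (z : 'C(p, 2).-tuple bool) : R :=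
  fine (\int[lebesgue_sym R p]_A (prior_unnorm z A)%:E).

Definition prior_pdf p (z : 'C(p, 2).-tuple bool) (A : 'M[R]_p) : R :=
  (prior_const z)^-1 * prior_unnorm z A.

Definition indicator_unnorm p (z : 'C(p, 2).-tuple bool) : R :=
  prior_const z *
  \prod_(i < p) \prod_(j < p | (i < j)%N)
    (prob ^+ zentry z i j * (1 - prob) ^+ (1 - zentry z i j)%N).

Definition indicator_pmf p (z : 'C(p, 2).-tuple bool) : R :=
  (\sum_(z' : 'C(p, 2).-tuple bool) indicator_unnorm z')^-1 *
  indicator_unnorm z.

Definition likelihood n p (A : 'M[R]_p) (y : 'M[R]_(n, p)) : R :=
  \prod_(k < n) mvn_pdf 0 (invmx A) (row k y)^T.

Context {d} {T : measurableType d} (P : probability T R).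

(* The joint law of (Z, Omega, Y), given by the prior of Z, the density of Omega
   given Z and that of Y given Omega, which does not involve Z; its values on
   rectangles determine it. *)
Definition spike_slab_model n p (Y : {RV P >-> 'M[R]_(n, p)})
    (Omega : {RV P >-> 'M[R]_p}) (Z : {RV P >-> 'C(p, 2).-tuple bool}) :=
  forall z D B, measurable D -> measurable B ->
  P (Z @^-1` [set z] `&` Omega @^-1` B `&` Y @^-1` D) =
  ((indicator_pmf z)%:E * \int[lebesgue_sym R p]_(A in B)
     ((prior_pdf z A)%:E *
      \int[lebesgue_mx R n p]_(y in D) (likelihood A y)%:E))%E.

End spike_slab.

(* Main.v *)
(* The Schur complement [v] of [Omega11] linearises everything that couples the
   last column to the rest: [Omega] is positive definite iff [Omega11] is and
   [v > 0], and [det Omega = det Omega11 * v].  For fixed [Omega11] and [u] the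
   passage from [omega22] to [v] is a translation, so it preserves Lebesgue
   measure, and on each event [Z = z] the joint density of [(Y, Omega11, u, v)] is
   a function of [(Y, Omega11)] times [v^(n/2) exp (- (s22 + lambda) v / 2)] times
   [exp (- u^T C^-1 u / 2 - s12^T u)].  Completing the square identifies the
   factors as a Gamma and a Gaussian density up to constants that are free of [v],
   resp. [u]; Tonelli's theorem then turns the conditional densities into regular
   conditional distributions.  The normalising constants of the prior cancel. *)

Require Import Defs.
From HB Require Import structures.
From mathcomp Require Import all_boot all_order all_algebra.
From mathcomp Require Import all_classical all_reals all_analysis.
From mathcomp Require Import measurable_realfun.
From mathcomp Require Import ring lra.

Set Implicit Arguments.
Unset Strict Implicit.
Unset Printing Implicit Defensive.

Import Order.TTheory GRing.Theory Num.Theory.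
Import numFieldNormedType.Exports.

Local Open Scope classical_set_scope.
Local Open Scope ring_scope.

(** * Schur complements and positive definite matrices *)

(** For fixed values of the other variables, the joint density is a constant [h] times a probability
    density [k] in the variable of interest. Integrating the indicator of [A] against [h k], or the
    constant mass of [A] under [k] against [h k], then gives the same number. That is all a regular
    conditional distribution asks for once Tonelli has moved this variable innermost. The constant
    [h] is never computed explicitly: it is the ratio of the two densities at a reference point,
    [u = 0] resp. [v = 1]. Two obstacles shape the rest. Lebesgue measure on symmetric matrices is
    the image of an iterated measure on tuples, so block coordinates must be read off the packed
    column order, in which the last column comes last. And a kernel is a measurable family of
    probability measures at every value of the conditioning variables, while the formula for the
    covariance is meaningful only for positive definite [Omega11]; hence the measurability of the
    inverse and of the cone, and a substitute density off the cone, which only a null event can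
    reach. *)

Section positive_definite.
Context {R : realType}.

Lemma trmx_inv_sym n (A : 'M[R]_n) : A^T = A -> (invmx A)^T = invmx A.
Proof. by move=> As; rewrite trmx_inv As. Qed.

Lemma posdef_sym n (A : 'M[R]_n) : posdef A -> A^T = A.
Proof. by case. Qed.

Lemma posdef_unitmx n (A : 'M[R]_n) : posdef A -> A \in unitmx.
Proof.
move=> [As Ap]; rewrite unitmxE unitfE; apply/det0P => -[v v0 vA].
have /Ap : v^T != 0 by rewrite trmx_eq0.
by rewrite trmxK vA mul0mx mxE ltxx.
Qed.

Lemma posdef_congr n (P A : 'M[R]_n) :
  P \in unitmx -> posdef (P *m A *m P^T) <-> posdef A.
Proof.
have impl (Q B : 'M[R]_n) : Q \in unitmx -> posdef B -> posdef (Q *m B *m Q^T).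
  move=> uQ [Bs Bp]; split; first by rewrite !trmx_mul trmxK Bs mulmxA.
  move=> x x0; rewrite -mulmxA -[_ *m x]mulmxA -[_ *m (Q^T *m x)]mulmxA !mulmxA.
  rewrite -[x^T *m Q]trmxK trmx_mul trmxK -2!mulmxA mulmxA; apply: Bp.
  apply: contra_neq x0 => Qx0.
  by rewrite -[x]mul1mx -(@mulVmx _ _ Q^T) ?unitmx_tr// -mulmxA Qx0 mulmx0.
move=> uP; split; last exact: impl.
move=> /(impl (invmx P)); rewrite unitmx_inv => /(_ uP).
by rewrite !mulmxA mulVmx// mul1mx -mulmxA -trmx_mul mulVmx// trmx1 mulmx1.
Qed.

Lemma posdef_invmx n (A : 'M[R]_n) : posdef A -> posdef (invmx A).
Proof.
move=> Ap; have uA := posdef_unitmx Ap.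
rewrite -(posdef_congr (invmx A) uA) (posdef_sym Ap).
by rewrite mulmxV// mul1mx.
Qed.

Lemma posdef_scale n (a : R) (A : 'M[R]_n) : 0 < a -> posdef A -> posdef (a *: A).
Proof.
move=> a0 [As Ap]; split; first by rewrite linearZ/= As.
by move=> x x0; rewrite -scalemxAr -scalemxAl mxE mulr_gt0// Ap.
Qed.

Lemma posdef_add n (A B : 'M[R]_n) : posdef A -> posdef B -> posdef (A + B).
Proof.
move=> [As Ap] [Bs Bp]; split; first by rewrite linearD/= As Bs.
by move=> x x0; rewrite mulmxDr mulmxDl mxE addr_gt0// ?Ap ?Bp.
Qed.

Lemma posdef_diag_mx n (e : 'rV[R]_n) :
  (forall i, 0 < e 0 i) -> posdef (diag_mx e).
Proof.
move=> e0; split; first by rewrite tr_diag_mx.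
move=> x x0; rewrite -mulmxA mul_diag_mx mxE.
have [i xi] : exists i, x i 0 != 0.
  apply/existsP; apply: contra_neqT x0; rewrite negb_exists => /forallP x0.
  by apply/matrixP => i j; rewrite ord1 mxE; exact/eqP/negPn/x0.
rewrite (bigD1 i)//= ltr_pwDl//.
  by rewrite !mxE mulrCA mulr_gt0// -expr2 exprn_even_gt0.
by apply: sumr_ge0 => j _; rewrite !mxE mulrCA mulr_ge0 ?(ltW (e0 _))// -expr2 sqr_ge0.
Qed.

Lemma posdef_mx11 (A : 'M[R]_1) : posdef A <-> 0 < A 0 0.
Proof.
split=> [[_ /(_ 1%:M)]|A0].
  by rewrite trmx1 mul1mx mulmx1; apply; rewrite -[_%:M]/(1 : 'M[R]_1) oner_neq0.
split; first by apply/matrixP => i j; rewrite mxE !ord1.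
move=> x x0; rewrite !mxE big_ord1 !mxE big_ord1 !mxE mulrAC -expr2 mulr_gt0//.
rewrite exprn_even_gt0//=; apply: contra_neq x0 => x0.
by apply/matrixP => i j; rewrite !ord1 mxE.
Qed.

Lemma posdef_block_diag n1 n2 (A : 'M[R]_n1) (D : 'M[R]_n2) :
  posdef (block_mx A 0 0 D) <-> posdef A /\ posdef D.
Proof.
have q (x : 'cV[R]_(n1 + n2)) : (x^T *m block_mx A 0 0 D *m x) 0 0 =
    ((usubmx x)^T *m A *m usubmx x) 0 0 + ((dsubmx x)^T *m D *m dsubmx x) 0 0.
  rewrite -{1 2}[x]vsubmxK tr_col_mx mul_row_block mul_row_col !mulmx0.
  by rewrite addr0 add0r mxE.
rewrite /posdef/= tr_block_mx !trmx0; split=> [[/eq_block_mx[As _ _ Ds] p]|].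
  split; split=> // x x0.
    have := p (col_mx x 0); rewrite q col_mxKu col_mxKd mulmx0 [X in _ + X]mxE addr0.
    by apply; apply: contra_neq x0 => /colP x0; apply/colP => i;
      have := x0 (lshift n2 i); rewrite col_mxEu !mxE.
  have := p (col_mx 0 x); rewrite q col_mxKu col_mxKd mulmx0 [X in X + _]mxE add0r.
  by apply; apply: contra_neq x0 => /colP x0; apply/colP => i;
    have := x0 (rshift n1 i); rewrite col_mxEd !mxE.
move=> [[As Ap] [Ds Dp]]; split=> [|x x0]; first by rewrite As Ds.
rewrite q; have [u0|u0] := eqVneq (usubmx x) 0.
  rewrite u0 mulmx0 mxE add0r Dp//; apply: contra_neq x0 => d0.
  by rewrite -[x]vsubmxK u0 d0 col_mx0.
rewrite ltr_pwDl ?Ap//; have [->|d0] := eqVneq (dsubmx x) 0.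
  by rewrite mulmx0 mxE.
by rewrite ltW// Dp.
Qed.

Definition schur n1 n2 (A : 'M[R]_n1) (B : 'M[R]_(n1, n2)) (D : 'M[R]_n2) :=
  D - B^T *m invmx A *m B.

Lemma posdef_ulsubmx n1 n2 (M : 'M[R]_(n1 + n2)) : posdef M -> posdef (ulsubmx M).
Proof.
move=> [Ms Mp]; split; first by rewrite trmx_ulsub Ms.
move=> x x0; have := Mp (col_mx x 0).
rewrite -{1}[M]submxK tr_col_mx trmx0 mul_row_block !mul0mx !addr0 mul_row_col.
rewrite mulmx0 addr0; apply; apply: contra_neq x0 => /colP x0; apply/colP => i.
by have := x0 (lshift n2 i); rewrite col_mxEu !mxE.
Qed.

(** Block form of the LDL' factorisation. The outer factor is unit triangular, so it is a congruence
    for definiteness and has determinant 1: both [posdef_schur] and [det_schur] follow from this one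
    identity. *)
Lemma block_mx_schur n1 n2 (A : 'M[R]_n1) (B : 'M[R]_(n1, n2)) (D : 'M[R]_n2) :
  A \in unitmx -> A^T = A ->
  let P := block_mx 1%:M 0 (B^T *m invmx A) 1%:M in
  block_mx A B B^T D = P *m block_mx A 0 0 (schur A B D) *m P^T.
Proof.
move=> uA As /=; rewrite tr_block_mx !trmx1 trmx0 trmx_mul trmxK trmx_inv_sym//.
rewrite !mulmx_block !mul1mx !mulmx1 !mul0mx !mulmx0 !(addr0, add0r).
rewrite -[B^T *m invmx A *m A]mulmxA mulVmx// mulmx1.
by rewrite mulmxA mulmxV// mul1mx mulmxA /schur addrC subrK.
Qed.

Lemma posdef_schur n1 n2 (A : 'M[R]_n1) (B : 'M[R]_(n1, n2)) (D : 'M[R]_n2) :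
  posdef (block_mx A B B^T D) <-> posdef A /\ posdef (schur A B D).
Proof.
(* The factorisation needs [A] invertible. Either side of the equivalence yields [posdef A], so it
   may be assumed from the start. *)
suff H : posdef A -> posdef (block_mx A B B^T D) <-> posdef A /\ posdef (schur A B D).
  split=> [p|[p q]]; last exact/H.
  by apply/H => //; have := posdef_ulsubmx p; rewrite block_mxKul.
move=> Ap; rewrite (block_mx_schur _ _ (posdef_unitmx Ap) (posdef_sym Ap)).
cbv zeta; rewrite posdef_congr ?posdef_block_diag; first by split=> [[]|].
by rewrite unitmxE det_lblock !det1 mulr1 unitr1.
Qed.

Lemma det_schur n1 n2 (A : 'M[R]_n1) (B : 'M[R]_(n1, n2)) (D : 'M[R]_n2) :
  posdef A -> \det (block_mx A B B^T D) = \det A * \det (schur A B D).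
Proof.
move=> Ap; rewrite (block_mx_schur _ _ (posdef_unitmx Ap) (posdef_sym Ap)).
by rewrite !det_mulmx det_tr det_lblock !det1 det_ublock !(mulr1, mul1r).
Qed.

(** Induction peels off the first row and column: the determinant is the first pivot times the
    determinant of its Schur complement, which is again positive definite. *)
Lemma posdef_det_gt0 n (A : 'M[R]_n) : posdef A -> 0 < \det A.
Proof.
elim: n A => [|n IHn] A Ap; first by rewrite det_mx00.
have := Ap; rewrite -[A](@submxK _ 1 n 1 n).
rewrite -[dlsubmx _]trmxK trmx_dlsub (posdef_sym Ap) => /(iffLR (@posdef_schur 1 n _ _ _))[p1 p2].
by rewrite (@det_schur 1 n)// mulr_gt0 ?IHn// det_mx11; exact/posdef_mx11.
Qed.

End positive_definite.

(** * Measurability of matrix functions *)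

Section measurable_matrix_functions.
Context {R : realType}.

(** Inversion is discontinuous at 0, so it is expressed through the measurable real power of
    exponent -1, extended to negative arguments by oddness. *)
Lemma measurable_inv : measurable_fun [set: R] (@GRing.inv R).
Proof.
rewrite (_ : @GRing.inv R =
    fun x => if 0 <= x then x `^ (-1) else - ((- x) `^ (-1))).
  apply: measurable_fun_ifT => /=; first exact: measurable_fun_ler.
    exact: measurable_powR.
  apply: measurable_funN; refine (measurableT_comp (measurable_powR (-1)) _).
  exact: measurable_funN.
apply/funext => x; case: leP => x0; first by rewrite powR_inv1.
by rewrite powR_inv1 ?invrN ?opprK// oppr_ge0 ltW.
Qed.

Lemma measurable_sqrtr : measurable_fun [set: R] (@Num.sqrt R).
Proof. by apply: continuous_measurable_fun; exact: sqrt_continuous. Qed.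

Lemma measurable_mx_coord d (T : measurableType d) m n i j :
  measurable_fun [set: 'M[T]_(m, n)] (fun M => M i j).
Proof.
move=> _ A mA; rewrite setTI; apply: sub_sigma_algebra; exists (i, j) => //.
by exists A => //; rewrite setTI.
Qed.

Context {d} {T : measurableType d}.

Lemma measurable_mx_entry m n (f : T -> 'M[R]_(m, n)) i j :
  measurable_fun [set: T] f -> measurable_fun [set: T] (fun x => f x i j).
Proof.
by move=> mf; exact: (measurableT_comp (measurable_mx_coord i j)).
Qed.

Lemma measurable_addmx m n (f g : T -> 'M[R]_(m, n)) :
  measurable_fun [set: T] f -> measurable_fun [set: T] g ->
  measurable_fun [set: T] (fun x => f x + g x).
Proof.
move=> mf mg; apply: measurable_fun_mx => i j; under eq_fun do rewrite mxE.
by apply: measurable_funD; exact: measurable_mx_entry.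
Qed.

Lemma measurable_oppmx m n (f : T -> 'M[R]_(m, n)) :
  measurable_fun [set: T] f -> measurable_fun [set: T] (fun x => - f x).
Proof.
move=> mf; apply: measurable_fun_mx => i j; under eq_fun do rewrite mxE.
by apply: measurableT_comp => //; exact: measurable_mx_entry.
Qed.

Lemma measurable_scalemx m n (a : T -> R) (f : T -> 'M[R]_(m, n)) :
  measurable_fun [set: T] a -> measurable_fun [set: T] f ->
  measurable_fun [set: T] (fun x => a x *: f x).
Proof.
move=> ma mf; apply: measurable_fun_mx => i j; under eq_fun do rewrite mxE.
by apply: measurable_funM => //; exact: measurable_mx_entry.
Qed.

Lemma measurable_mulmx m n p (f : T -> 'M[R]_(m, n)) (g : T -> 'M[R]_(n, p)) :
  measurable_fun [set: T] f -> measurable_fun [set: T] g ->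
  measurable_fun [set: T] (fun x => f x *m g x).
Proof.
move=> mf mg; apply: measurable_fun_mx => i j; under eq_fun do rewrite mxE.
by apply: measurable_sum => k; apply: measurable_funM; exact: measurable_mx_entry.
Qed.

Lemma measurable_trmx m n (f : T -> 'M[R]_(m, n)) :
  measurable_fun [set: T] f -> measurable_fun [set: T] (fun x => (f x)^T).
Proof.
move=> mf; apply: measurable_fun_mx => i j; under eq_fun do rewrite mxE.
exact: measurable_mx_entry.
Qed.

Lemma measurable_row m n i (f : T -> 'M[R]_(m, n)) :
  measurable_fun [set: T] f -> measurable_fun [set: T] (fun x => row i (f x)).
Proof.
move=> mf; apply: measurable_fun_mx => j k; under eq_fun do rewrite mxE.
exact: measurable_mx_entry.
Qed.

Lemma measurable_ulsubmx m1 m2 n1 n2 (f : T -> 'M[R]_(m1 + m2, n1 + n2)) :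
  measurable_fun [set: T] f -> measurable_fun [set: T] (fun x => ulsubmx (f x)).
Proof.
move=> mf; apply: measurable_fun_mx => j k; under eq_fun do rewrite !mxE.
exact: measurable_mx_entry.
Qed.

Lemma measurable_ursubmx m1 m2 n1 n2 (f : T -> 'M[R]_(m1 + m2, n1 + n2)) :
  measurable_fun [set: T] f -> measurable_fun [set: T] (fun x => ursubmx (f x)).
Proof.
move=> mf; apply: measurable_fun_mx => j k; under eq_fun do rewrite !mxE.
exact: measurable_mx_entry.
Qed.

Lemma measurable_drsubmx m1 m2 n1 n2 (f : T -> 'M[R]_(m1 + m2, n1 + n2)) :
  measurable_fun [set: T] f -> measurable_fun [set: T] (fun x => drsubmx (f x)).
Proof.
move=> mf; apply: measurable_fun_mx => j k; under eq_fun do rewrite !mxE.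
exact: measurable_mx_entry.
Qed.

Lemma measurable_row_mx m n1 n2 (f : T -> 'M[R]_(m, n1)) (g : T -> 'M[R]_(m, n2)) :
  measurable_fun [set: T] f -> measurable_fun [set: T] g ->
  measurable_fun [set: T] (fun x => row_mx (f x) (g x)).
Proof.
move=> mf mg; apply: measurable_fun_mx => i j; under eq_fun do rewrite mxE.
by case: (fintype.split j) => k; exact: measurable_mx_entry.
Qed.

Lemma measurable_col_mx m1 m2 n (f : T -> 'M[R]_(m1, n)) (g : T -> 'M[R]_(m2, n)) :
  measurable_fun [set: T] f -> measurable_fun [set: T] g ->
  measurable_fun [set: T] (fun x => col_mx (f x) (g x)).
Proof.
move=> mf mg; apply: measurable_fun_mx => i j; under eq_fun do rewrite mxE.
by case: (fintype.split i) => k; exact: measurable_mx_entry.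
Qed.

Lemma measurable_det n (f : T -> 'M[R]_n) :
  measurable_fun [set: T] f -> measurable_fun [set: T] (fun x => \det (f x)).
Proof.
move=> mf; apply: measurable_sum => s; apply: measurable_funM => //.
by apply: measurable_prod => i _; exact: measurable_mx_entry.
Qed.

(** [invmx] is the cofactor formula on invertible matrices and the identity elsewhere; the
    determinant decides measurably between the two, and cofactors are polynomial in the entries. *)
Lemma measurable_invmx n (f : T -> 'M[R]_n) :
  measurable_fun [set: T] f -> measurable_fun [set: T] (fun x => invmx (f x)).
Proof.
move=> mf; rewrite /invmx; apply: measurable_fun_ifT => //=.
  under eq_fun do rewrite unitmxE unitfE.
  apply: measurable_neg; apply: measurable_fun_eqr => //; exact: measurable_det.
apply: measurable_scalemx.
  by refine (measurableT_comp measurable_inv _); exact: measurable_det.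
apply: measurable_fun_mx => i j; under eq_fun do rewrite !mxE.
apply: measurable_funM => //; apply: measurable_det.
apply: measurable_fun_mx => k l; under eq_fun do rewrite !mxE.
exact: measurable_mx_entry.
Qed.

End measurable_matrix_functions.

(** The definition quantifies over uncountably many vectors. Schur complements replace it by a
    recursive test: finitely many symmetry equations, a positive first pivot, and the same test on a
    matrix of size one less. *)
Lemma measurable_posdef {R : realType} n : measurable (@posdef R n).
Proof.
elim: n => [|n IHn].
  rewrite (_ : @posdef R 0 = setT)//; apply/seteqP; split=> // A _; split.
    by apply/matrixP => -[].
  by move=> x; rewrite (flatmx0 x) eqxx.
pose f (A : 'M[R]_(1 + n)) :=
  schur (ulsubmx A) (ursubmx A) (drsubmx A).
have mf : measurable_fun [set: _] f.
  apply: measurable_addmx; first exact: measurable_drsubmx.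
  apply: measurable_oppmx; apply: measurable_mulmx; last exact: measurable_ursubmx.
  apply: measurable_mulmx; first by apply: measurable_trmx; exact: measurable_ursubmx.
  by apply: measurable_invmx; exact: measurable_ulsubmx.
have -> : @posdef R n.+1 = (\bigcap_i \bigcap_j [set A : 'M[R]_(1 + n) | A i j = A j i])
    `&` [set A | 0 < A 0 0] `&` f @^-1` (@posdef R n).
  apply/seteqP; split=> [A Ap|A [[As A0 fA]]].
    have := Ap; rewrite -{1}[A](@submxK _ 1 n 1 n).
    rewrite -[dlsubmx _]trmxK trmx_dlsub (posdef_sym Ap).
    move=> /(iffLR (@posdef_schur _ 1 n _ _ _))[p1 p2]; split=> //; split.
      by move=> i _ j _ /=; rewrite -{1}(posdef_sym Ap) mxE.
    by move: p1 => /posdef_mx11; rewrite !mxE/= !lshift0.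
  have {}As : A^T = A by apply/matrixP => i j; rewrite mxE; apply: As.
  rewrite -[A](@submxK _ 1 n 1 n).
  rewrite -[dlsubmx _]trmxK trmx_dlsub As; apply/(@posdef_schur _ 1 n); split=> //.
  by apply/posdef_mx11; rewrite !mxE/= !lshift0.
apply: measurableI; last by rewrite -[X in measurable X]setTI; exact: mf.
apply: measurableI.
  apply: fin_bigcap_measurable => // i _; apply: fin_bigcap_measurable => // j _.
  rewrite (_ : [set _ | _] = (fun A : 'M[R]_(1 + n) => A i j == A j i) @^-1` [set true]).
    rewrite -[X in measurable X]setTI.
    by apply: measurable_fun_eqr => //; exact: measurable_mx_coord.
  by apply/seteqP; split => A /=/eqP.
rewrite -[X in measurable X]setTI.
apply: (@measurable_fun_ltr _ _ _ _ (cst 0) (fun A : 'M[R]_(1 + n) => A 0 0)) => //.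
exact: measurable_mx_coord.
Qed.

(** * Densities and affine changes of variable *)

(** Both proofs are arguments so that the measure structure can be attached to the term itself. *)
Definition density_measure d (T : measurableType d) (R : realType)
    (mu : {measure set T -> \bar R}) (f : T -> R)
    of (forall x, 0 <= f x) & measurable_fun [set: T] f :=
  fun A => (\int[mu]_(x in A) (f x)%:E)%E.

Section density_measure.
Local Open Scope ereal_scope.
Context d (T : measurableType d) (R : realType).
Variables (mu : {measure set T -> \bar R}) (f : T -> R).
Hypotheses (f0 : forall x, (0 <= f x)%R) (mf : measurable_fun [set: T] f).

Local Notation dens := (density_measure mu f0 mf).

Let dens0 : dens set0 = 0. Proof. exact: integral_set0. Qed.

Let dens_ge0 A : 0 <= dens A.
Proof. by apply: integral_ge0 => x _; exact: f0. Qed.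

Let dens_sigma_additive : semi_sigma_additive dens.
Proof.
move=> F mF tF mUF; rewrite [X in _ --> X](_ : _ = \sum_(n <oo) dens (F n)).
  apply/cvg_closeP; split; last by rewrite closeE.
  by apply: is_cvg_nneseries => *; exact: dens_ge0.
rewrite -ge0_integral_bigcup//; first exact/measurable_EFinP/measurable_funTS.
by move=> x _; rewrite lee_fin.
Qed.

HB.instance Definition _ :=
  isMeasure.Build _ _ _ dens dens0 dens_ge0 dens_sigma_additive.

Import HBNNSimple.

(** True for indicators by definition of the measure, for simple functions by linearity, and in
    general by monotone convergence along the simple approximations on both sides. *)
Lemma ge0_integral_density_measure (g : T -> \bar R) :
  (forall x, 0 <= g x) -> measurable_fun [set: T] g ->
  \int[dens]_x g x = \int[mu]_x (g x * (f x)%:E).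
Proof.
move=> g0 mg; pose h := nnsfun_approx measurableT mg.
have hg x : (h n x)%:E @[n --> \oo] --> g x by exact: cvg_nnsfun_approx.
transitivity (limn (fun n => \int[dens]_x (h n x)%:E)).
  rewrite -monotone_convergence//.
  - by apply: eq_integral => x _; apply/esym/cvg_lim.
  - by move=> n; exact/measurable_EFinP.
  - by move=> n x _; rewrite lee_fin.
  - by move=> x _ m n mn; rewrite lee_fin; exact/lefP/nd_nnsfun_approx.
transitivity (limn (fun n => \int[mu]_x ((h n x)%:E * (f x)%:E))); last first.
  rewrite -monotone_convergence//.
  - by apply: eq_integral => x _; apply/cvg_lim => //; exact: cvgeZr.
  - by move=> n; apply: emeasurable_funM; exact/measurable_EFinP.
  - by move=> n x _; rewrite mule_ge0 ?lee_fin.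
  - move=> x _ m n mn; rewrite lee_wpmul2r ?lee_fin//.
    exact/lefP/nd_nnsfun_approx.
congr (limn _); apply/funext => n.
under [LHS]eq_integral do rewrite fimfunE -fsumEFin//.
rewrite ge0_integral_fsum//; last 2 first.
- by move=> r; exact/measurable_EFinP/measurableT_comp.
- by move=> r x _; rewrite nnfun_muleindic_ge0.
under [RHS]eq_integral.
  move=> x _; rewrite fimfunE -fsumEFin// ge0_mule_fsuml; last first.
    by move=> r; rewrite nnfun_muleindic_ge0.
  over.
rewrite ge0_integral_fsum//; last 2 first.
- move=> k; apply: emeasurable_funM; last exact/measurable_EFinP.
  exact/measurable_EFinP/measurableT_comp.
- by move=> k x _; rewrite mule_ge0 ?lee_fin// -lee_fin nnfun_muleindic_ge0.
apply: eq_fsbigr => r rh; rewrite integralZl_indic_nnsfun//.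
have r0 : (0 <= r)%R by move: rh; rewrite inE => -[x _ <-].
under [RHS]eq_integral do rewrite EFinM -muleA.
rewrite ge0_integralZl_EFin//; last 2 first.
- by move=> x _; rewrite mule_ge0 ?lee_fin.
- by apply: emeasurable_funM; exact/measurable_EFinP.
congr (_ * _); rewrite integral_indic// setIT.
rewrite -[LHS]/(\int[mu]_(x in h n @^-1` [set r]) (f x)%:E) integral_mkcond.
by apply: eq_integral => x _; rewrite epatch_indic muleC.
Qed.

End density_measure.

Section lebesgue_affine.
Context {R : realType}.
Local Notation mu := (@lebesgue_measure R).

(** The image of Lebesgue measure under a translation gives half-open intervals their length, and
    Lebesgue measure is the only measure that does. *)
Lemma ge0_integral_shift (c : R) (f : R -> \bar R) :
  (forall x, 0 <= f x)%E -> measurable_fun [set: R] f ->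
  (\int[mu]_x f (x + c)%R = \int[mu]_x f x)%E.
Proof.
move=> f0 mf; pose s : R -> measurableTypeR R := fun x => x + c.
have ms : measurable_fun [set: R] s by exact: measurable_funD.
transitivity (\int[pushforward mu s]_x f x)%E.
  by rewrite ge0_integral_pushforward.
apply: eq_measure_integral.
move=> A mA _; apply/esym/lebesgue_measure_unique => // _ [[a b]] _ <-.
rewrite -[RHS]/(mu (s @^-1` `]a, b]%classic)).
rewrite (_ : s @^-1` _ = `]a - c, b - c]%classic).
  rewrite !lebesgue_measure_itv/= !lte_fin ltrD2r; case: ifP => // _.
  by rewrite -!EFinB opprB addrA subrK.
by apply/seteqP; split=> x /=; rewrite !in_itv/= ltrBlDr lerBrDr.
Qed.

Lemma ge0_integral_scale (b : R) (f : R -> \bar R) : 0 < b ->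
  (forall x, 0 <= f x)%E -> measurable_fun [set: R] f ->
  (\int[mu]_x f (b * x)%R = b^-1%:E * \int[mu]_x f x)%E.
Proof.
move=> b0 f0 mf; pose s : R -> measurableTypeR R := fun x => b * x.
have ms : measurable_fun [set: R] s by exact: measurable_funM.
have bi0 : 0 <= b^-1 by rewrite invr_ge0 ltW.
transitivity (\int[pushforward mu s]_x f x)%E.
  by rewrite ge0_integral_pushforward.
rewrite -(@ge0_integral_mscale _ _ _ _ _ _ (NngNum bi0)) //.
apply: eq_measure_integral => A mA _.
(* The image under multiplication by [b] divides lengths by [b]; the factor [b] restores them, so
   uniqueness applies to [m]. *)
pose m : {measure set (measurableTypeR R) -> \bar R} :=
  mscale (NngNum (ltW b0))
    (measure_function_pushforward__canonical__measure_function_Measure mu ms).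
have Hm : mu A = m A.
  apply: lebesgue_measure_unique => // _ [[x y]] _ <-.
  rewrite -[RHS]/(b%:E * mu (s @^-1` `]x, y]%classic))%E.
  rewrite (_ : s @^-1` _ = `]x / b, y / b]%classic).
    rewrite !lebesgue_measure_itv/= !lte_fin ltr_pM2r ?invr_gt0//.
    case: ifP => // _; last by rewrite mule0.
    by rewrite -!EFinB -EFinM -mulrBl mulrC divfK ?gt_eqF.
  by apply/seteqP; split=> z /=; rewrite !in_itv/= ltr_pdivrMr// ler_pdivlMr// mulrC.
transitivity ((b^-1)%:E * m A)%E; last by rewrite -Hm.
rewrite -[m A]/(b%:E * mu (s @^-1` A))%E muleA -EFinM mulVf ?gt_eqF//.
by rewrite mul1e.
Qed.

End lebesgue_affine.

(** * Lebesgue measure on tuples and matrices *)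

Section lebesgue_tuple_integral.
Local Open Scope ereal_scope.
Context {R : realType}.

Lemma measurable_tuple_cat m n :
  measurable_fun [set: m.-tuple R * n.-tuple R] (fun x => [tuple of x.1 ++ x.2]).
Proof.
apply/measurable_fun_tnthP => i /=; case: (split_ordP i) => j ->.
  rewrite (_ : _ \o _ = (@tnth _ R ^~ j) \o fst).
    by apply: measurableT_comp => //; exact: measurable_tnth.
  by apply/funext => -[a b] /=; rewrite tnth_lshift.
rewrite (_ : _ \o _ = (@tnth _ R ^~ j) \o snd).
  by apply: measurableT_comp => //; exact: measurable_tnth.
by apply/funext => -[a b] /=; rewrite tnth_rshift.
Qed.

Lemma ge0_integral_tuple_cons n (F : n.+1.-tuple R -> \bar R) :
  (forall t, 0 <= F t) -> measurable_fun [set: n.+1.-tuple R] F ->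
  \int[lebesgue_tuple R n.+1]_t F t =
  \int[@lebesgue_measure R]_x \int[lebesgue_tuple R n]_t F [tuple of x :: t].
Proof.
move=> F0 mF; have mc : measurable_fun [set: _] (@tcons R n) by exact: measurable_cons.
rewrite [LHS](ge0_integral_pushforward mc)//.
rewrite preimage_setT fubini_tonelli1//; last by move=> x /=.
exact: measurableT_comp.
Qed.

Lemma measurable_integral_tuple_cat m n (F : (m + n).-tuple R -> \bar R) :
  (forall t, 0 <= F t) -> measurable_fun [set: (m + n).-tuple R] F ->
  measurable_fun [set: m.-tuple R]
    (fun a => \int[lebesgue_tuple R n]_b F [tuple of a ++ b]).
Proof.
move=> F0 mF; pose G (x : m.-tuple R * n.-tuple R) := F [tuple of x.1 ++ x.2].
have mG : measurable_fun [set: _] G.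
  by apply: measurableT_comp => //; exact: measurable_tuple_cat.
by refine (measurable_fun_fubini_tonelli_F (m2 := lebesgue_tuple R n) G mG _) => x;
  exact: F0.
Qed.

(** Tonelli, one coordinate of the first part at a time. At [m = 0] the measure is a Dirac mass at
    the empty tuple, so the outer integral is an evaluation. *)
Lemma ge0_integral_tuple_cat m n (F : (m + n).-tuple R -> \bar R) :
  (forall t, 0 <= F t) -> measurable_fun [set: (m + n).-tuple R] F ->
  \int[lebesgue_tuple R (m + n)]_t F t =
  \int[lebesgue_tuple R m]_a \int[lebesgue_tuple R n]_b F [tuple of a ++ b].
Proof.
elim: m F => [|m IHm] F F0 mF.
  rewrite [RHS]integral_dirac//=.
    rewrite diracT mul1e; apply: eq_integral => t _; congr F; exact: val_inj.
  exact: (@measurable_integral_tuple_cat 0 n).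
have mG := measurable_integral_tuple_cat F0 mF.
rewrite [RHS]ge0_integral_tuple_cons//; last by move=> t; exact: integral_ge0.
rewrite [LHS](@ge0_integral_tuple_cons (m + n))//.
apply: eq_integral => x _; rewrite IHm//.
  by apply: eq_integral => a _; apply: eq_integral => b _; congr F; exact: val_inj.
by apply: measurableT_comp => //; exact: measurable_cons.
Qed.

Lemma ge0_integral_tuple1 (F : 1.-tuple R -> \bar R) :
  (forall t, 0 <= F t) -> measurable_fun [set: 1.-tuple R] F ->
  \int[lebesgue_tuple R 1]_t F t = \int[@lebesgue_measure R]_x F [tuple x].
Proof.
move=> F0 mF; rewrite ge0_integral_tuple_cons//; apply: eq_integral => x _.
rewrite [LHS]integral_dirac//= ?diracT ?mul1e; first by congr F; exact: val_inj.
by apply: measurableT_comp => //; exact: measurable_cons.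
Qed.

(** Needed because the number of entries of a bordered symmetric matrix and the sum of the sizes of
    its blocks are equal only up to a proof, not by computation. *)
Lemma integral_tcast m n (e : m = n) (F : m.-tuple R -> \bar R) :
  \int[lebesgue_tuple R m]_t F t =
  \int[lebesgue_tuple R n]_t F (tcast (esym e) t).
Proof. by case: n / e; apply: eq_integral => t _; rewrite tcast_id. Qed.

End lebesgue_tuple_integral.

Section matrix_of_tuple.
Context {R : realType}.

Lemma measurable_mx_of_tuple m n :
  measurable_fun [set: (m * n).-tuple R] (@mx_of_tuple R m n).
Proof.
apply: measurable_fun_mx => i j; under eq_fun do rewrite mxE.
exact: measurable_tnth.
Qed.

Lemma measurable_sym_of_tuple p :
  measurable_fun [set: 'C(p.+1, 2).-tuple R] (@sym_of_tuple R p).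
Proof.
apply: measurable_fun_mx => i j.
have [k|k] := ltnP ('C((maxn i j).+1, 2) + minn i j) 'C(p.+1, 2).
  rewrite (_ : (fun _ => _) = (@tnth _ R ^~ (Ordinal k))).
    exact: measurable_tnth.
  by apply/funext => t; rewrite mxE (tnth_nth 0).
rewrite (_ : (fun _ => _) = cst 0); first exact: measurable_cst.
by apply/funext => t; rewrite mxE nth_default ?size_tuple.
Qed.

(** [mxvec_index] is the rank of a pair in an enumeration. With a single column the pairs are listed
    like their first components, so the rank is [i]. *)
Lemma mx_of_tuple_col m (t : (m * 1).-tuple R) i : mx_of_tuple t i 0 = t`_i.
Proof.
rewrite mxE (tnth_nth 0); congr (_`_ _) => /=; rewrite /mxvec_index/=.
rewrite /enum_rank enum_rank_in.unlock insubdK/=; last first.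
  by rewrite -topredE/= cardE index_mem mem_enum.
have e1 : enum 'I_1 = [:: 0] by apply: (inj_map val_inj); rewrite val_enum_ord.
rewrite enumT unlock/= /prod_enum e1 allpairs1r.
rewrite (index_map (f := fun x => (x, 0 : 'I_1))); last by move=> x y [].
exact: index_enum_ord.
Qed.

(** Packing column by column puts the leading block first, then the off-diagonal part of the last
    column, then the corner; bordering a matrix is therefore concatenation of tuples. *)
Lemma sym_of_tuple_block m (t : 'C((m + 1).+1, 2).-tuple R)
    (a : 'C(m.+1, 2).-tuple R) (b : (m * 1).-tuple R) (w : R) :
  tval t = a ++ b ++ [:: w] ->
  sym_of_tuple t = block_mx (sym_of_tuple a) (mx_of_tuple b) (mx_of_tuple b)^T w%:M.
Proof.
have ltn_m1 (i : 'I_m) : (i < m * 1)%N by rewrite muln1.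
(* Position of the entry in row [j] of column [i]: it is below 'C(i+1, 2) + i + 1 = 'C(i+2, 2),
   which is at most 'C(m+1, 2), so it falls in the first segment. *)
have lt_bin (i j : nat) : (j <= i -> i < m -> 'C(i.+1, 2) + j < 'C(m.+1, 2))%N.
  move=> ji im; apply: (@leq_trans 'C(i.+2, 2)); last exact: leq_bin2l.
  by rewrite [leqRHS]binS bin1 -addnS leq_add2l.
move=> tE; apply/matrixP => i j; rewrite mxE tE nth_cat size_tuple.
case: (split_ordP i) => i' ->; case: (split_ordP j) => j' ->;
  rewrite ?block_mxEul ?block_mxEur ?block_mxEdl ?block_mxEdr/=.
- by rewrite lt_bin ?mxE// ?gtn_max ?ltn_ord// geq_min leq_maxl.
- rewrite ord1 addn0 (maxn_idPr (ltnW _))// (minn_idPl (ltnW _))//.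
  by rewrite ltnNge leq_addr/= addKn nth_cat size_tuple ltn_m1 mx_of_tuple_col.
- rewrite ord1 addn0 (maxn_idPl (ltnW _))// (minn_idPr (ltnW _))// ltnNge leq_addr/=.
  by rewrite addKn nth_cat size_tuple ltn_m1 [RHS]mxE mx_of_tuple_col.
- rewrite !ord1 addn0 maxnn minnn ltnNge leq_addr/= addKn nth_cat size_tuple.
  by rewrite [X in (_ < X)%N]muln1 ltnn [X in (_ - X)%N]muln1 subnn/= mxE.
Qed.

End matrix_of_tuple.

Section matrix_integral.
Local Open Scope ereal_scope.
Context {R : realType}.

Lemma measurable_tcast d (T : measurableType d) m n (e : m = n) :
  measurable_fun [set: m.-tuple T] (tcast e).
Proof.
case: n / e; rewrite (_ : tcast _ = id)//.
Qed.

Lemma measurable_fun_tuple_cat d (T : measurableType d) m n (f : T -> m.-tuple R)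
    (g : T -> n.-tuple R) :
  measurable_fun [set: T] f -> measurable_fun [set: T] g ->
  measurable_fun [set: T] (fun x => [tuple of f x ++ g x]).
Proof.
move=> mf mg; exact: (measurableT_comp (@measurable_tuple_cat R m n)
  (measurable_fun_pair mf mg)).
Qed.

Lemma ge0_integral_lebesgue_mx m n (F : 'M[R]_(m, n) -> \bar R) :
  (forall A, 0 <= F A) -> measurable_fun [set: 'M[R]_(m, n)] F ->
  \int[lebesgue_mx R m n]_A F A = \int[lebesgue_tuple R (m * n)]_t F (mx_of_tuple t).
Proof.
move=> F0 mF; rewrite [LHS](ge0_integral_pushforward (@measurable_mx_of_tuple R m n))//.
Qed.

Lemma ge0_integral_lebesgue_sym m (F : 'M[R]_m -> \bar R) :
  (forall A, 0 <= F A) -> measurable_fun [set: 'M[R]_m] F ->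
  \int[lebesgue_sym R m]_A F A =
  \int[lebesgue_tuple R 'C(m.+1, 2)]_t F (sym_of_tuple t).
Proof.
move=> F0 mF; rewrite [LHS](ge0_integral_pushforward (@measurable_sym_of_tuple R m))//.
Qed.

Lemma ge0_integral_lebesgue_sym_block m (F : 'M[R]_(m + 1) -> \bar R) :
  (forall A, 0 <= F A) -> measurable_fun [set: 'M[R]_(m + 1)] F ->
  \int[lebesgue_sym R (m + 1)]_A F A =
  \int[lebesgue_tuple R 'C(m.+1, 2)]_a \int[lebesgue_tuple R (m * 1)]_b
    \int[@lebesgue_measure R]_w
      F (block_mx (sym_of_tuple a) (mx_of_tuple b) (mx_of_tuple b)^T w%:M).
Proof.
move=> F0 mF; rewrite ge0_integral_lebesgue_sym//.
have e : 'C((m + 1).+1, 2) = ('C(m.+1, 2) + (m * 1 + 1))%N.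
  by rewrite addn1 binS bin1 muln1 addn1.
have mFs : measurable_fun [set: _] (F \o @sym_of_tuple R (m + 1)).
  by apply: measurableT_comp => //; exact: measurable_sym_of_tuple.
have mFt := measurableT_comp mFs (measurable_tcast (esym e)).
rewrite (integral_tcast e) ge0_integral_tuple_cat//.
apply: eq_integral => a _; rewrite ge0_integral_tuple_cat//; last first.
  by refine (measurableT_comp mFt _); exact: measurable_fun_tuple_cat.
apply: eq_integral => b _; rewrite ge0_integral_tuple1//; last first.
  refine (measurableT_comp mFt _); apply: measurable_fun_tuple_cat => //.
  exact: measurable_fun_tuple_cat.
apply: eq_integral => w _; congr F; apply: sym_of_tuple_block.
by rewrite val_tcast.
Qed.

End matrix_integral.

(** * Gaussian integrals in several variables *)

Section gaussian_integral.
Context {R : realType}.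

Definition qform n (A : 'M[R]_n) (x : 'cV[R]_n) : R := (x^T *m A *m x) 0 0.

Lemma qform_diag n1 n2 (A : 'M[R]_n1) (D : 'M[R]_n2) x y :
  qform (block_mx A 0 0 D) (col_mx x y) = qform A x + qform D y.
Proof.
by rewrite /qform tr_col_mx mul_row_block mul_row_col !mulmx0 addr0 add0r mxE.
Qed.

Lemma qform_congr n (P A : 'M[R]_n) x :
  qform (P *m A *m P^T) x = qform A (P^T *m x).
Proof. by rewrite /qform trmx_mul trmxK !mulmxA. Qed.

(** Completing the square in [x] for fixed [y]: the cross term is absorbed by a shift of [x], and
    the Schur complement is what remains in [y]. *)
Lemma qform_schur n1 n2 (A : 'M[R]_n1) (B : 'M[R]_(n1, n2)) (D : 'M[R]_n2) x y :
  posdef A ->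
  qform (block_mx A B B^T D) (col_mx x y) =
  qform A (x + invmx A *m B *m y) + qform (schur A B D) y.
Proof.
move=> Ap; rewrite (block_mx_schur _ _ (posdef_unitmx Ap) (posdef_sym Ap)) qform_congr.
rewrite tr_block_mx !trmx1 trmx0 trmx_mul trmxK trmx_inv_sym ?posdef_sym//.
by rewrite mul_block_col !mul1mx mul0mx add0r qform_diag.
Qed.

Lemma measurable_qform d (T : measurableType d) n (A : T -> 'M[R]_n) (x : T -> 'cV[R]_n) :
  measurable_fun [set: T] A -> measurable_fun [set: T] x ->
  measurable_fun [set: T] (fun t => qform (A t) (x t)).
Proof.
move=> mA mx; apply: measurable_mx_entry; apply: measurable_mulmx => //.
by apply: measurable_mulmx => //; exact: measurable_trmx.
Qed.

Lemma integral_gauss1 (q c : R) : 0 < q ->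
  (\int[@lebesgue_measure R]_x (expR (- (q * (x - c) ^+ 2) / 2))%:E =
   (Num.sqrt (2 * pi / q))%:E)%E.
Proof.
(* [normal_pdf] takes a standard deviation; a precision [q] corresponds to [s = q^(-1/2)]. *)
move=> q0; pose s := (Num.sqrt q)^-1.
have s0 : s != 0 by rewrite invr_eq0 gt_eqF// sqrtr_gt0.
have s2 : s ^+ 2 = q^-1 by rewrite exprVn sqr_sqrtr// ltW.
have k0 : 0 < Num.sqrt (2 * pi / q).
  by rewrite sqrtr_gt0 divr_gt0// mulr_gt0// pi_gt0.
transitivity (\int[@lebesgue_measure R]_x
    ((Num.sqrt (2 * pi / q))%:E * (normal_pdf c s x)%:E))%E.
  apply: eq_integral => x _; rewrite normal_pdfE// /normal_peak /normal_fun s2 -EFinM.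
  rewrite (_ : q^-1 * pi *+ 2 = 2 * pi / q); last by rewrite -mulr_natl; ring.
  rewrite mulVKf ?gt_eqF//; congr (expR _)%:E.
  by rewrite -mulr_natr; field; rewrite gt_eqF.
rewrite ge0_integralZl_EFin//; last 2 first.
- by move=> x _; rewrite lee_fin normal_pdf_ge0.
- by apply/measurable_EFinP; exact: measurable_normal_pdf.
by rewrite integral_normal_pdf mule1.
Qed.

Lemma measurable_gauss n (A : 'M[R]_n) (mu : 'cV[R]_n) :
  measurable_fun [set: (n * 1).-tuple R]
    (fun t => (expR (- qform A (mx_of_tuple t - mu) / 2))%:E).
Proof.
apply/measurable_EFinP; apply: measurableT_comp => //.
apply: measurable_funM => //; apply: measurable_funN.
apply: measurable_qform => //; apply: measurable_addmx => //.
exact: measurable_mx_of_tuple.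
Qed.

(** Induction on the dimension. After completing the square, the first coordinate is Gaussian around
    a centre that depends on the others, but its mass does not; the other coordinates carry the
    Schur complement, and determinants multiply. *)
Lemma integral_gauss n (Q : 'M[R]_n) (mu : 'cV[R]_n) : posdef Q ->
  (\int[lebesgue_tuple R (n * 1)]_t
     (expR (- qform Q (mx_of_tuple t - mu) / 2))%:E =
   (Num.sqrt ((2 * pi) ^+ n / \det Q))%:E)%E.
Proof.
elim: n => [|n IHn] in Q mu *; move=> Qp.
  rewrite det_mx00 expr0 divr1 sqrtr1 [LHS]integral_dirac//; last exact: (@measurable_gauss 0).
  by rewrite diracT mul1e /qform [_ - mu]flatmx0 mulmx0 mxE oppr0 mul0r expR0.
(* [n.+1 * 1] computes to [(n * 1).+1], so a column vector can be peeled as a tuple without a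
   cast. *)
rewrite [LHS](@ge0_integral_tuple_cons _ (n * 1))//; last exact: (@measurable_gauss n.+1).
pose q : 'M[R]_1 := @ulsubmx _ 1 n 1 n Q.
pose B : 'M[R]_(1, n) := @ursubmx _ 1 n 1 n Q.
pose D : 'M[R]_n := @drsubmx _ 1 n 1 n Q.
pose mu1 : R := @usubmx _ 1 n 1 mu 0 0.
pose mu2 : 'cV[R]_n := @dsubmx _ 1 n 1 mu.
have QE : Q = block_mx q B B^T D.
  have -> : B^T = @dlsubmx _ 1 n 1 n Q by rewrite trmx_ursub (posdef_sym Qp).
  by rewrite [RHS](@submxK _ 1 n 1 n).
have [qp Sp] : posdef q /\ posdef (schur q B D).
  by apply/posdef_schur; rewrite -QE.
have dQ : \det Q = q 0 0 * \det (schur q B D).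
  by rewrite QE [LHS](det_schur B D qp) det_mx11.
have q0 : 0 < q 0 0 by exact/posdef_mx11.
(* The conditional mean of the first coordinate given the remaining ones. *)
pose c (t : (n * 1).-tuple R) : R := mu1 - (q 0 0)^-1 * (B *m (mx_of_tuple t - mu2)) 0 0.
have QxE x (t : (n * 1).-tuple R) :
    qform Q (mx_of_tuple ([tuple of x :: t] : (n.+1 * 1).-tuple R) - mu) =
    q 0 0 * (x - c t) ^+ 2 + qform (schur q B D) (mx_of_tuple t - mu2).
  have -> : mx_of_tuple ([tuple of x :: t] : (n.+1 * 1).-tuple R) - mu =
      col_mx (x - mu1)%:M (mx_of_tuple t - mu2) :> 'cV[R]_(1 + n).
    apply/matrixP => i j; rewrite [in LHS]mxE ord1 mx_of_tuple_col [RHS]mxE.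
    case: (@split_ordP 1 n i) => k ->.
      by rewrite !ord1 /mu1 !mxE.
    by rewrite [RHS]mxE mx_of_tuple_col /mu2 !mxE.
  rewrite QE [LHS](qform_schur B D (x - mu1)%:M (mx_of_tuple t - mu2) qp).
  congr +%R; set w := mx_of_tuple t - mu2.
  have -> : (x - mu1)%:M + invmx q *m B *m w = (x - c t)%:M.
    rewrite -mulmxA [B *m w]mx11_scalar [q]mx11_scalar invmx_scalar mul_scalar_mx.
    by rewrite scale_scalar_mx -raddfD/=; congr _%:M; rewrite /c -/w; ring.
  rewrite /qform tr_scalar_mx [in LHS](mx11_scalar q) -!scalar_mxM mxE eqxx mulr1n.
  by ring.
transitivity (\int[@lebesgue_measure R]_x \int[lebesgue_tuple R (n * 1)]_t
  ((expR (- (q 0 0 * (x - c t) ^+ 2) / 2))%:E *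
   (expR (- qform (schur q B D) (mx_of_tuple t - mu2) / 2))%:E))%E.
  apply: eq_integral => x _; apply: eq_integral => t _.
  by rewrite QxE -EFinM -expRD -mulrDl opprD.
pose G (x : measurableTypeR R * (n * 1).-tuple R) : \bar R :=
  ((expR (- (q 0 0 * (x.1 - c x.2) ^+ 2) / 2))%:E *
   (expR (- qform (schur q B D) (mx_of_tuple x.2 - mu2) / 2))%:E)%E.
transitivity (\int[lebesgue_tuple R (n * 1)]_t \int[@lebesgue_measure R]_x G (x, t))%E.
  apply: (fubini_tonelli G); last by move=> x; rewrite /G mule_ge0.
  have mq : measurable_fun [set: measurableTypeR R * (n * 1).-tuple R]
      (fun x => mx_of_tuple x.2 - mu2).
    apply: measurable_addmx => //.
    by apply: measurableT_comp => //; exact: measurable_mx_of_tuple.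
  apply: emeasurable_funM; apply/measurable_EFinP; apply: measurableT_comp => //.
    apply: measurable_funM => //; apply: measurable_funN; apply: measurable_funM => //.
    apply: measurable_funX; apply: measurable_funB => //; apply: measurable_funB => //.
    apply: measurable_funM => //; apply: measurable_mx_entry.
    exact: measurable_mulmx.
  apply: measurable_funM => //; apply: measurable_funN; exact: measurable_qform.
transitivity (\int[lebesgue_tuple R (n * 1)]_t
  ((Num.sqrt (2 * pi / q 0 0))%:E *
   (expR (- qform (schur q B D) (mx_of_tuple t - mu2) / 2))%:E))%E.
  apply: eq_integral => t _; rewrite /G/= ge0_integralZr//.
    by rewrite integral_gauss1.
  apply/measurable_EFinP; apply: measurableT_comp => //.
  apply: measurable_funM => //; apply: measurable_funN; apply: measurable_funM => //.
  by apply: measurable_funX; exact: measurable_funB.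
rewrite ge0_integralZl_EFin//.
rewrite IHn// -EFinM -sqrtrM; last by rewrite divr_ge0 ?(ltW q0)// mulr_ge0// pi_ge0.
rewrite dQ exprS invfM; congr (Num.sqrt _)%:E; ring.
exact: measurable_gauss.
Qed.

End gaussian_integral.

(** * Probability kernels, Gaussian and Gamma masses *)

Section density_kernel.
Local Open Scope ereal_scope.
Context {dW dU dV} {W : measurableType dW} {U : measurableType dU}
  {V : measurableType dV} {R : realType}.
Variables (nu : {sigma_finite_measure set U -> \bar R}) (f : U -> V)
  (k : W * U -> R).
Hypotheses (mf : measurable_fun [set: U] f) (k0 : forall x, (0 <= k x)%R)
  (mk : measurable_fun [set: W * U] k)
  (k1 : forall w, \int[nu]_u (k (w, u))%:E = 1).

Let k0w w u : (0 <= k (w, u))%R. Proof. exact: k0. Qed.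

Let mkw w : measurable_fun [set: U] (fun u => k (w, u)).
Proof. exact: measurableT_comp. Qed.

(** Pushing along [f] turns a density over tuples into a kernel on column vectors. The normalisation
    is an argument so that the probability kernel structure can be attached to the term. *)
Definition density_kernel of (forall w, \int[nu]_u (k (w, u))%:E = 1) :
    W -> {measure set V -> \bar R} := fun w =>
  measure_function_pushforward__canonical__measure_function_Measure
    (density_measure nu (k0w w) (mkw w)) mf.

Local Notation kernel := (density_kernel k1).

Lemma density_kernelE w A : measurable A ->
  kernel w A = \int[nu]_u ((k (w, u))%:E * (\1_A (f u))%:E).
Proof.
move=> mA; rewrite -[LHS]/(\int[nu]_(u in f @^-1` A) (k (w, u))%:E).
by rewrite integral_mkcond; apply: eq_integral => u _; rewrite epatch_indic.
Qed.

Let measurable_density_kernel A : measurable A ->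
  measurable_fun [set: W] (kernel ^~ A).
Proof.
move=> mA; under eq_fun do rewrite density_kernelE//.
pose g (x : W * U) := (k x)%:E * (\1_A (f x.2))%:E.
apply: (measurable_fun_fubini_tonelli_F (m2 := nu) g).
- apply: emeasurable_funM; apply/measurable_EFinP => //.
  refine (measurableT_comp (measurable_indic mA) _).
  exact: measurableT_comp.
- by move=> x; rewrite mule_ge0// lee_fin.
Qed.

HB.instance Definition _ := isKernel.Build _ _ _ _ _
  kernel measurable_density_kernel.

Let density_kernel_setT w : kernel w setT = 1.
Proof.
rewrite density_kernelE// -(k1 w); apply: eq_integral => u _.
by rewrite indicT mule1.
Qed.

HB.instance Definition _ := Kernel_isProbability.Build _ _ _ _ _
  kernel density_kernel_setT.

(** Both sides equal [c] times the kernel mass of [A]: on the right that mass is a constant and [k]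
    integrates to 1. This is the conditioning identity with all other variables frozen. *)
Lemma integral_density_kernel w A (c : R) : measurable A -> (0 <= c)%R ->
  \int[nu]_u ((\1_A (f u))%:E * (c * k (w, u))%:E) =
  \int[nu]_u (kernel w A * (c * k (w, u))%:E).
Proof.
move=> mA c0; have mk' : measurable_fun [set: U] (fun u => (k (w, u))%:E).
  by apply/measurable_EFinP; exact: mkw.
transitivity (c%:E * kernel w A).
  rewrite density_kernelE// -ge0_integralZl_EFin//.
  - by apply: eq_integral => u _; rewrite EFinM muleCA (muleC (\1_A (f u))%:E).
  - by move=> u _; rewrite mule_ge0 ?lee_fin.
  - apply: emeasurable_funM => //; apply/measurable_EFinP.
    exact: (measurableT_comp (measurable_indic mA)).
transitivity (\int[nu]_u (c%:E * kernel w A * (k (w, u))%:E)).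
  rewrite ge0_integralZl//; last by rewrite mule_ge0// lee_fin.
    by rewrite k1 mule1.
  by move=> u _; rewrite lee_fin.
by apply: eq_integral => u _; rewrite EFinM muleA [kernel w A * _]muleC.
Qed.

End density_kernel.

Section distribution_mass.
Context {R : realType}.

Lemma mvn_pdf_ge0 n (mu : 'cV[R]_n) C x : 0 <= mvn_pdf mu C x.
Proof. by rewrite /mvn_pdf mulr_ge0 ?expR_ge0// invr_ge0 sqrtr_ge0. Qed.

Lemma measurable_mvn_pdf d (T : measurableType d) n (mu : T -> 'cV[R]_n)
    (C : T -> 'M[R]_n) (x : T -> 'cV[R]_n) :
  measurable_fun [set: T] mu -> measurable_fun [set: T] C ->
  measurable_fun [set: T] x ->
  measurable_fun [set: T] (fun t => mvn_pdf (mu t) (C t) (x t)).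
Proof.
move=> mmu mC mx; apply: measurable_funM.
  refine (measurableT_comp measurable_inv _).
  refine (measurableT_comp measurable_sqrtr _).
  by apply: measurable_funM => //; exact: measurable_det.
apply: measurableT_comp => //; apply: measurable_funM => //.
apply: measurable_funN; apply: (@measurable_qform R _ T n); first exact: measurable_invmx.
by apply: measurable_addmx => //; exact: measurable_oppmx.
Qed.

Lemma integral_mvn_pdf n (mu : 'cV[R]_n) C : posdef C ->
  (\int[lebesgue_tuple R (n * 1)]_t (mvn_pdf mu C (mx_of_tuple t))%:E = 1)%E.
Proof.
move=> Cp; have dC := posdef_det_gt0 Cp.
have D0 : 0 < (2 * pi) ^+ n * \det C by rewrite mulr_gt0// exprn_gt0// mulr_gt0// pi_gt0.
under eq_integral do rewrite /mvn_pdf EFinM.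
rewrite ge0_integralZl_EFin//; last exact: measurable_gauss.
rewrite (integral_gauss mu (posdef_invmx Cp)) det_inv invrK -EFinM mulVf//.
by rewrite gt_eqF// sqrtr_gt0.
Qed.

Lemma mvnE n (mu : 'cV[R]_n) C A : measurable A ->
  mvn mu C A =
  (\int[lebesgue_tuple R (n * 1)]_t
     ((mvn_pdf mu C (mx_of_tuple t))%:E * (\1_A (mx_of_tuple t))%:E))%E.
Proof.
move=> mA; rewrite /mvn integral_mkcond ge0_integral_lebesgue_mx.
- by apply: eq_integral => t _; rewrite epatch_indic.
- by move=> x; rewrite epatch_indic mule_ge0 ?lee_fin ?mvn_pdf_ge0.
- apply/(measurable_restrictT _ mA)/measurable_funTS/measurable_EFinP.
  by apply: measurable_mvn_pdf.
Qed.

Local Notation leb := (@lebesgue_measure R).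

(** Take [ln s <= s - 1] at [s = t / (2 * a + 1)] and multiply by [a]: since
    [a / (2 * a + 1) <= 1 / 2], the power costs at most half of the exponential decay. The [+ 1]
    keeps the denominator positive at [a = 0]. *)
Lemma gamma_integrand_bound (a t : R) : 0 <= a -> 0 < t ->
  t `^ a * expR (- t) <= expR (a * (ln (2 * a + 1) - 1)) * expR (- t / 2).
Proof.
move=> a0 t0; have c0 : 0 < 2 * a + 1 by lra.
rewrite -!expRD /powR gt_eqF// -expRD ler_expR.
have : ln (t / (2 * a + 1)) <= t / (2 * a + 1) - 1.
  have := expR_ge1Dx (ln (t / (2 * a + 1))).
  by rewrite lnK ?posrE ?divr_gt0//; lra.
rewrite ln_div ?posrE// => /(ler_wpM2l a0) h.
have : a * (t / (2 * a + 1)) <= t / 2.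
  rewrite mulrCA ler_pM2l// ler_pdivrMr// ; lra.
lra.
Qed.

Lemma measurable_gamma_integrand (a : R) (D : set R) :
  measurable_fun D (fun t => (t `^ a * expR (- t))%:E).
Proof.
apply/measurable_EFinP/measurable_funTS/measurable_funM; first exact: measurable_powR.
exact: measurableT_comp.
Qed.

Lemma integral_gamma_lty (a : R) : 0 <= a ->
  (\int[leb]_(t in `]0%R, +oo[) (t `^ a * expR (- t))%:E < +oo)%E.
Proof.
(* The factor 2 cancels the rate [1 / 2] in front of the exponential density used as dominating
   function. *)
move=> a0; pose k := 2 * expR (a * (ln (2 * a + 1) - 1)).
have k0 : 0 <= k by rewrite mulr_ge0// expR_ge0.
have h0 : 0 < 2^-1 :> R by rewrite invr_gt0.
have me : measurable_fun [set: R] (fun t => (exponential_pdf 2^-1 t)%:E).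
  by apply/measurable_EFinP; exact: measurable_exponential_pdf.
have e0 t : (0 <= (exponential_pdf 2^-1 t)%:E :> \bar R)%E.
  by rewrite lee_fin; apply: exponential_pdf_ge0; exact: ltW.
have mke : measurable_fun [set: R] (fun t => k%:E * (exponential_pdf 2^-1 t)%:E)%E.
  exact: emeasurable_funM.
apply: (@le_lt_trans _ _ (\int[leb]_t (k%:E * (exponential_pdf 2^-1 t)%:E))%E); last first.
  by rewrite ge0_integralZl_EFin// integral_exponential_pdf// mule1 ltry.
apply: (@le_trans _ _ (\int[leb]_(t in `]0%R, +oo[) (k%:E * (exponential_pdf 2^-1 t)%:E))%E).
  apply: ge0_le_integral => //.
  - by move=> t _; rewrite lee_fin mulr_ge0 ?powR_ge0 ?expR_ge0.
  - exact: measurable_gamma_integrand.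
  - exact: measurable_funTS.
  - move=> t /=; rewrite in_itv/= andbT => t0; rewrite -EFinM lee_fin.
    rewrite exponential_pdfE ?(ltW t0)// (le_trans (gamma_integrand_bound a0 t0))//.
    rewrite /k [_ * t]mulrC mulrN mulNr -mulrA [leRHS]mulrCA mulVKf//.
by apply: ge0_subset_integral => // t _; rewrite mule_ge0// lee_fin.
Qed.

(** [gamma_fun] is a [fine] of an integral; finiteness guarantees that it is not the default value
    0. *)
Lemma gamma_funE (a : R) : 1 <= a ->
  ((gamma_fun a)%:E = \int[leb]_(t in `]0%R, +oo[) (t `^ (a - 1) * expR (- t))%:E)%E.
Proof.
move=> a1; rewrite /gamma_fun fineK// ge0_fin_numE.
  by apply: integral_gamma_lty; rewrite subr_ge0.
by apply: integral_ge0 => t _; rewrite lee_fin mulr_ge0 ?powR_ge0 ?expR_ge0.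
Qed.

(** On [[1, 2]] the integrand is at least [expR (- 2)], because the exponent [a - 1] is
    nonnegative. *)
Lemma gamma_fun_gt0 (a : R) : 1 <= a -> 0 < gamma_fun a.
Proof.
move=> a1; rewrite -lte_fin gamma_funE//.
have I12 : `[1%R, 2%R]%classic `<=` (`]0%R, +oo[%classic : set R).
  by move=> t /=; rewrite !in_itv/= andbT => /andP[t1 _]; lra.
apply: (@lt_le_trans _ _ (\int[leb]_(t in `[1%R, 2%R]) (expR (- 2))%:E)%E).
  rewrite integral_cst//= lebesgue_measure_itv/= lte_fin ltr1n -EFinD -EFinM lte_fin.
  by rewrite mulr_gt0 ?expR_gt0// subr_gt0 ltr1n.
apply: (@le_trans _ _ (\int[leb]_(t in `[1%R, 2%R]) (t `^ (a - 1) * expR (- t))%:E)%E).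
  apply: ge0_le_integral => //.
  - exact: measurable_gamma_integrand.
  - move=> t /=; rewrite in_itv/= => /andP[t1 t2].
    rewrite lee_fin -[leLHS]mul1r ler_pM ?expR_ge0//; last by rewrite ler_expR lerN2.
    by rewrite /powR gt_eqF ?(lt_le_trans _ t1)// -[leLHS]expR0 ler_expR mulr_ge0 ?subr_ge0 ?ln_ge0.
apply: ge0_subset_integral => //; first exact: measurable_gamma_integrand.
by move=> t _; rewrite lee_fin mulr_ge0 ?powR_ge0 ?expR_ge0.
Qed.

Lemma gamma_pdf_ge0 (a b x : R) : 1 <= a -> 0 <= gamma_pdf a b x.
Proof.
move=> a1; rewrite /gamma_pdf; case: ifP => // x0.
by rewrite !mulr_ge0 ?powR_ge0 ?expR_ge0// invr_ge0 ltW// gamma_fun_gt0.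
Qed.

Lemma measurable_gamma_pdf d (T : measurableType d) (a : R) (b x : T -> R) :
  measurable_fun [set: T] b -> measurable_fun [set: T] x ->
  measurable_fun [set: T] (fun t => gamma_pdf a (b t) (x t)).
Proof.
move=> mb mx; apply: measurable_fun_ifT => //=; first exact: measurable_fun_ltr.
apply: measurable_funM; last first.
  by apply: measurableT_comp => //; apply: measurable_funN; exact: measurable_funM.
apply: measurable_funM; last by refine (measurableT_comp (measurable_powR _) _).
by apply: measurable_funM => //; refine (measurableT_comp (measurable_powR _) _).
Qed.

Lemma integral_gamma_pdf (a b : R) : 1 <= a -> 0 < b ->
  (\int[leb]_x (gamma_pdf a b x)%:E = 1)%E.
Proof.
move=> a1 b0; have G0 := gamma_fun_gt0 a1.
pose g (t : R) : \bar R := (if 0 < t then t `^ (a - 1) * expR (- t) else 0)%:E.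
have g0 t : (0 <= g t)%E.
  by rewrite /g lee_fin; case: ifP => // _; rewrite mulr_ge0 ?powR_ge0 ?expR_ge0.
have mg : measurable_fun [set: R] g.
  apply/measurable_EFinP; apply: measurable_fun_ifT => //=.
    exact: measurable_fun_ltr.
  by apply/measurable_EFinP; exact: measurable_gamma_integrand.
have mgb : measurable_fun [set: R] (fun x => g (b * x)).
  by apply: measurableT_comp => //; exact: measurable_funM.
transitivity (\int[leb]_x ((b / gamma_fun a)%:E * g (b * x)%R))%E.
  apply: eq_integral => x _; rewrite /g /gamma_pdf pmulr_rgt0//.
  case: ifP => x0; rewrite -EFinM ?mulr0//; congr (_%:E).
  rewrite powRM ?(ltW b0) ?(ltW x0)//.
  have -> : b `^ a = b `^ (a - 1) * b.
    rewrite -[X in _ * X]powRr1 ?(ltW b0)// -powRD ?subrK//.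
    by rewrite (gt_eqF b0) implybT.
  by rewrite [b * x]mulrC; ring.
rewrite ge0_integralZl_EFin//; last by rewrite divr_ge0// ltW.
rewrite ge0_integral_scale// (_ : (\int[leb]_x g x = (gamma_fun a)%:E)%E).
  rewrite -!EFinM; apply/eqP; rewrite eqe; apply/eqP.
  by field; rewrite !gt_eqF.
rewrite gamma_funE// [RHS]integral_mkcond; apply: eq_integral => t _.
rewrite /g patchE; case: ifPn => t0.
  by rewrite mem_set//= in_itv/= t0.
by rewrite memNset//= in_itv/= andbT; exact/negP.
Qed.

Lemma gamma_distE (a b : R) A : measurable A ->
  gamma_dist a b A = (\int[leb]_x ((gamma_pdf a b x)%:E * (\1_A x)%:E))%E.
Proof.
move=> mA; rewrite /gamma_dist integral_mkcond.
by apply: eq_integral => x _; rewrite epatch_indic.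
Qed.

End distribution_mass.

(** * The joint density in terms of the Schur complement *)

Section spike_slab_density.
Context {R : realType}.
Variables (v0 v1 lambda : R).
Hypotheses (v0_gt0 : 0 < v0) (v1_gt0 : 0 < v1) (lambda_gt0 : 0 < lambda).

Lemma sd_gt0 b : 0 < sd v0 v1 b.
Proof. by case: b. Qed.

Lemma prior_unnorm_ge0 p (z : 'C(p, 2).-tuple bool) A :
  0 <= prior_unnorm v0 v1 lambda z A.
Proof.
rewrite /prior_unnorm !mulr_ge0//.
  by apply: prodr_ge0 => i _; apply: prodr_ge0 => j _; exact: normal_pdf_ge0.
by apply: prodr_ge0 => i _; apply: exponential_pdf_ge0; rewrite divr_ge0// ltW.
Qed.

Lemma likelihood_ge0 n p (A : 'M[R]_p) (y : 'M[R]_(n, p)) : 0 <= likelihood A y.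
Proof. by apply: prodr_ge0 => k _; exact: mvn_pdf_ge0. Qed.

Lemma measurable_prior_unnorm p (z : 'C(p, 2).-tuple bool) :
  measurable_fun [set: 'M[R]_p] (prior_unnorm v0 v1 lambda z).
Proof.
apply: measurable_funM; last by apply: measurable_indic; exact: measurable_posdef.
apply: measurable_funM; apply: measurable_prod => i _.
  under eq_fun do rewrite big_mkcond.
  apply: measurable_prod => j _; case: (i < j)%N => //.
  refine (measurableT_comp (measurable_normal_pdf _ _) _).
  exact: measurable_mx_coord.
refine (measurableT_comp (measurable_exponential_pdf _) _).
exact: measurable_mx_coord.
Qed.

Lemma measurable_likelihood d (T : measurableType d) n p (A : T -> 'M[R]_p)
    (y : T -> 'M[R]_(n, p)) :
  measurable_fun [set: T] A -> measurable_fun [set: T] y ->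
  measurable_fun [set: T] (fun t => likelihood (A t) (y t)).
Proof.
move=> mA my; apply: measurable_prod => k _.
apply: measurable_mvn_pdf => //; first exact: measurable_invmx.
by apply: measurable_trmx; exact: measurable_row.
Qed.

Lemma qform_ge0 p (A : 'M[R]_p) x : posdef A -> 0 <= qform A x.
Proof.
move=> [_ Ap]; have [->|x0] := eqVneq x 0; first by rewrite /qform mulmx0 mxE.
exact/ltW/Ap.
Qed.

Lemma qform_complete_square p (Q : 'M[R]_p) (x s : 'cV[R]_p) : posdef Q ->
  qform Q (x + invmx Q *m s) =
  qform Q x + 2 * (x^T *m s) 0 0 + (s^T *m invmx Q *m s) 0 0.
Proof.
move=> Qp; rewrite /qform [(x + _)^T]linearD/= !mulmxDl !mulmxDr trmx_mul.
rewrite trmx_inv_sym ?posdef_sym// -!mulmxA.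
rewrite [invmx Q *m (Q *m _)]mulmxA mulVmx ?posdef_unitmx// mul1mx.
rewrite [Q *m (invmx Q *m _)]mulmxA mulmxV ?posdef_unitmx// mul1mx.
have -> : s^T *m x = x^T *m s.
  by rewrite [RHS]mx11_scalar -tr_scalar_mx -mx11_scalar trmx_mul trmxK.
by rewrite !mxE; ring.
Qed.

Variables (n m : nat).
Implicit Types (z : 'C(m + 1, 2).-tuple bool) (y : 'M[R]_(n, m + 1))
  (a : 'M[R]_m) (b : 'cV[R]_m) (v : R).

(** Inverse of the change of variables: the corner is chosen so that the Schur complement is exactly
    [v]. *)
Definition assemble a b v : 'M[R]_(m + 1) :=
  block_mx a b b^T (v + qform (invmx a) b)%:M.

Lemma schur_assemble a b v : schur a b (v + qform (invmx a) b)%:M = v%:M.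
Proof. by rewrite /schur [X in _ - X]mx11_scalar -raddfB/= addrK. Qed.

Lemma posdef_assemble a b v : posdef (assemble a b v) <-> posdef a /\ 0 < v.
Proof. by rewrite posdef_schur posdef_mx11 schur_assemble mxE mulr1n. Qed.

Lemma det_assemble a b v : posdef a -> \det (assemble a b v) = \det a * v.
Proof. by move=> ap; rewrite det_schur// schur_assemble det_mx11 mxE mulr1n. Qed.

Definition prior_offdiag z a := \prod_(i < m) \prod_(j < m | (i < j)%N)
  normal_pdf 0 (sd v0 v1 (zentry z i j)) (a i j).

Lemma prior_unnorm_assemble z a b v : posdef a -> 0 < v ->
  prior_unnorm v0 v1 lambda z (assemble a b v) =
  prior_offdiag z a *
  (\prod_(i < m) exponential_pdf (lambda / 2) (a i i)) *
  (\prod_(i < m) normal_peak (sd v0 v1 (zentry z i m))) * (lambda / 2) *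
  expR (- (\sum_(i < m) (sd v0 v1 (zentry z i m)) ^- 2 * b i 0 ^+ 2) / 2 -
        lambda / 2 * (v + qform (invmx a) b)).
Proof.
move=> ap v_gt0.
rewrite /prior_unnorm indicE mem_set ?mulr1; last exact/posdef_assemble.
(* Row [m] has no entry to the right of the diagonal, so its inner product is empty. *)
rewrite big_split_ord/= big_ord1 [X in _ * X * _]big1 ?mulr1; last first.
  by move=> j; rewrite addn0 ltnNge -ltnS -[m.+1]addn1 ltn_ord.
rewrite [in X in _ * X]big_split_ord/= big_ord1.
under [X in X * _]eq_bigr.
  move=> i _; rewrite big_split_ord/= big_ord1_cond/= addn0 ltn_ord.
  rewrite block_mxEur normal_pdfE ?gt_eqF ?sd_gt0//.
  under eq_bigr do rewrite block_mxEul.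
  over.
rewrite /= big_split/= big_split/=.
(* The exponential density is cut off at negative arguments, so the sign of the corner entry must be
   known before its formula is used. *)
have w_ge0 : 0 <= v + qform (invmx a) b.
  by rewrite addr_ge0 ?(ltW v_gt0)// qform_ge0//; exact: posdef_invmx.
under [X in _ * (X * _) = _]eq_bigr do rewrite block_mxEul.
rewrite block_mxEdr mxE eqxx mulr1n exponential_pdfE// -/(prior_offdiag z a).
have -> : \prod_(i < m) normal_fun 0 (sd v0 v1 (zentry z i m)) (b i ord0) =
    expR (- (\sum_(i < m) (sd v0 v1 (zentry z i m)) ^- 2 * b i 0 ^+ 2) / 2).
  rewrite -expR_sum; congr expR; rewrite -sumrN mulr_suml; apply: eq_bigr => i _.
  by rewrite subr0 -mulr_natr invfM [ord0]ord1 mulrA !mulNr [X in - (X / _)]mulrC.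
by rewrite expRD !mulNr; ring.
Qed.

Lemma qform_block11 a b (w : R) (x : 'cV[R]_m) (c : R) :
  qform (block_mx a b b^T w%:M) (col_mx x c%:M) =
  qform a x + 2 * c * (b^T *m x) 0 0 + w * c ^+ 2.
Proof.
rewrite /qform tr_col_mx tr_scalar_mx mul_row_block mul_row_col.
rewrite !mulmxDl -!scalar_mxM mul_scalar_mx mul_mx_scalar -scalemxAl.
have -> : x^T *m b = b^T *m x.
  by rewrite [RHS]mx11_scalar -tr_scalar_mx -mx11_scalar trmx_mul trmxK.
by rewrite !mxE eqxx !mulr1n; ring.
Qed.

(** Each row of [y] is split into its first [m] entries and its last one. Summed over the rows, the
    cross terms give [s12] and the squares of the last entries give [s22]. *)
Lemma likelihood_assemble y a b v : posdef a -> 0 < v ->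
  likelihood (assemble a b v) y =
  (Num.sqrt v) ^+ n * (Num.sqrt (\det a / (2 * pi) ^+ (m + 1))) ^+ n *
  expR (- (\sum_(k < n) qform a (row k (lsubmx y))^T) / 2
        - (b^T *m ursubmx (y^T *m y)) 0 0 -
        drsubmx (y^T *m y) 0 0 * (v + qform (invmx a) b) / 2).
Proof.
move=> ap v_gt0; rewrite /likelihood.

have pi2 : 0 < (2 * pi) ^+ (m + 1) :> R by rewrite exprn_gt0// mulr_gt0// pi_gt0.
have da := posdef_det_gt0 ap.
(* The determinant is [\det a * v], so every sample contributes one [Num.sqrt v]; the [n] of them
   form the power [v^(n/2)] of the Gamma density. *)
have peakE : (Num.sqrt ((2 * pi) ^+ (m + 1) * \det (invmx (assemble a b v))))^-1 =
    Num.sqrt v * Num.sqrt (\det a / (2 * pi) ^+ (m + 1)) :> R.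
  rewrite det_inv det_assemble// -sqrtrV -?sqrtrM ?(ltW v_gt0)//.
    by congr Num.sqrt; field; rewrite !gt_eqF.
  by rewrite mulr_ge0 ?(ltW pi2)// invr_ge0 mulr_ge0 ?ltW.
under eq_bigr do rewrite /mvn_pdf peakE subr0 invmxK.
rewrite big_split/= prodr_const card_ord exprMn; congr (_ * _).
rewrite -expR_sum; congr expR.
pose Y1 := lsubmx y; pose Y2 := rsubmx y.
have yE : y = row_mx Y1 Y2 by rewrite hsubmxK.
have -> : ursubmx (y^T *m y) = Y1^T *m Y2.
  by rewrite yE tr_row_mx mul_col_row block_mxKur.
have -> : drsubmx (y^T *m y) = Y2^T *m Y2.
  by rewrite yE tr_row_mx mul_col_row block_mxKdr.
have rowE k : (row k y)^T = col_mx (row k Y1)^T (Y2 k 0)%:M.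
  rewrite yE row_row_mx tr_row_mx; congr col_mx.
  by apply/matrixP => i j; rewrite !ord1 !mxE eqxx mulr1n.
have -> : (b^T *m (Y1^T *m Y2)) 0 0 = \sum_(k < n) Y2 k 0 * (b^T *m (row k Y1)^T) 0 0.
  rewrite mulmxA mxE; apply: eq_bigr => k _; rewrite mulrC; congr (_ * _).
  by rewrite !mxE; apply: eq_bigr => i _; rewrite !mxE.
have -> : (Y2^T *m Y2) 0 0 = \sum_(k < n) Y2 k 0 ^+ 2.
  by rewrite mxE; apply: eq_bigr => k _; rewrite mxE expr2.
transitivity (\sum_(k < n) (- qform a (row k Y1)^T / 2
    - Y2 k 0 * (b^T *m (row k Y1)^T) 0 0 - Y2 k 0 ^+ 2 * (v + qform (invmx a) b) / 2)).
  by apply: eq_bigr => k _; rewrite rowE -/(qform _ _) qform_block11; field.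
by rewrite !big_split/= !sumrN -!mulr_suml sumrN.
Qed.

Definition joint_density z y a b v :=
  prior_unnorm v0 v1 lambda z (assemble a b v) * likelihood (assemble a b v) y.

Lemma joint_density_ge0 z y a b v : 0 <= joint_density z y a b v.
Proof. by rewrite mulr_ge0 ?prior_unnorm_ge0 ?likelihood_ge0. Qed.

Lemma joint_density_eq0 z y a b v :
  ~ (posdef a /\ 0 < v) -> joint_density z y a b v = 0.
Proof.
move=> nav; rewrite /joint_density /prior_unnorm indicE memNset ?mulr0 ?mul0r//.
by move=> /= /posdef_assemble.
Qed.

Definition cond_rate y : R := drsubmx (y^T *m y) 0 0 + lambda.

Lemma cond_rate_gt0 y : 0 < cond_rate y.
Proof.
rewrite ltr_pwDr// !mxE; apply: sumr_ge0 => k _.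
by rewrite !mxE -expr2 sqr_ge0.
Qed.

(** The precision matrix whose inverse is the covariance [C] of the theorem; quadratic forms in [u]
    add up at this level. *)
Definition cond_prec z y a : 'M[R]_m :=
  cond_rate y *: invmx a + diag_mx (map_mx GRing.inv (ursubmx (Vmx v0 v1 z)))^T.

Lemma slab_varE z i : (ursubmx (Vmx v0 v1 z) : 'cV[R]_m) i 0 = sd v0 v1 (zentry z i m) ^+ 2.
Proof.
rewrite !mxE eq_lrshift /= addn0 (minn_idPl _) ?(maxn_idPr _)//; exact: ltnW.
Qed.

Lemma posdef_cond_prec z y a : posdef a -> posdef (cond_prec z y a).
Proof.
move=> ap; apply: posdef_add.
  by apply: posdef_scale; [exact: cond_rate_gt0|exact: posdef_invmx].
apply: posdef_diag_mx => i; rewrite mxE [map_mx _ _ _ _]mxE slab_varE.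
by rewrite invr_gt0 exprn_gt0// sd_gt0.
Qed.

Lemma qform_cond_prec z y a b : qform (cond_prec z y a) b =
  cond_rate y * qform (invmx a) b +
  \sum_(i < m) (sd v0 v1 (zentry z i m)) ^- 2 * b i 0 ^+ 2.
Proof.
rewrite /qform mulmxDr mulmxDl mxE -scalemxAr -scalemxAl [X in X + _]mxE.
congr (_ + _); rewrite -mulmxA mul_diag_mx mxE; apply: eq_bigr => i _.
rewrite [b^T _ _]mxE [in X in _ * X]mxE [(map_mx _ _)^T _ _]mxE [map_mx _ _ _ _]mxE.
by rewrite slab_varE expr2 mulrCA.
Qed.

(** [g] is chosen before [b] and [v]: this order of quantifiers is the separation of variables. The
    prior brings [lambda] and the likelihood [s22], both in front of the corner entry
    [v + qform (invmx a) b], hence the common rate. *)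
Lemma joint_densityE z y a : exists g : R, forall b v, posdef a -> 0 < v ->
  joint_density z y a b v =
  g * (Num.sqrt v ^+ n * expR (- (cond_rate y / 2 * v))) *
  expR (- qform (cond_prec z y a) b / 2 - (b^T *m ursubmx (y^T *m y)) 0 0).
Proof.
exists (prior_offdiag z a *
  (\prod_(i < m) exponential_pdf (lambda / 2) (a i i)) *
  (\prod_(i < m) normal_peak (sd v0 v1 (zentry z i m))) * (lambda / 2) *
  (Num.sqrt (\det a / (2 * pi) ^+ (m + 1))) ^+ n *
  expR (- (\sum_(k < n) qform a (row k (lsubmx y))^T) / 2)).
move=> b v ap v0'.
rewrite /joint_density prior_unnorm_assemble// likelihood_assemble// qform_cond_prec.
set S := \sum_(i < m) _; set q := qform (invmx a) b; set l := (b^T *m _) 0 0.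
set K := \sum_(k < n) _; rewrite /cond_rate; set s := drsubmx _ 0 0.
(* Writing the [b] factor as the prior and likelihood exponentials over the other two makes the goal
   a rational identity in exponentials, which [field] closes. *)
have -> : expR (- ((s + lambda) * q + S) / 2 - l) =
    expR (- S / 2 - lambda / 2 * (v + q)) * expR (- K / 2 - l - s * (v + q) / 2) /
    (expR (- K / 2) * expR (- ((s + lambda) / 2 * v))).
  by rewrite -!expRD -expRN -expRD; congr expR; field.
by field; rewrite !gt_eqF ?expR_gt0.
Qed.

Lemma joint_density_mvn z y a v : posdef a -> 0 < v ->
  let C := invmx (cond_prec z y a) in
  exists2 h, 0 <= h & forall b, joint_density z y a b v =
    h * mvn_pdf (- (C *m ursubmx (y^T *m y))) C b.
Proof.
move=> ap v_gt0' C; have Qp := posdef_cond_prec z y ap.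
have Cp : posdef C by exact: posdef_invmx.
set sv := ursubmx (y^T *m y).
have pk : 0 < (Num.sqrt ((2 * pi) ^+ m * \det C))^-1.
  rewrite invr_gt0 sqrtr_gt0 mulr_gt0 ?posdef_det_gt0// exprn_gt0// mulr_gt0//.
  exact: pi_gt0.
have mvn_gt0 b : 0 < mvn_pdf (- (C *m sv)) C b by rewrite mulr_gt0// expR_gt0.
(* The ratio of the densities at [b = 0]. It suffices that cross products at [b] and at 0 agree; the
   normalising factors and the constant left by completing the square are the same at both
   points. *)
exists (joint_density z y a 0 v / mvn_pdf (- (C *m sv)) C 0).
  by rewrite divr_ge0 ?joint_density_ge0// ltW.
move=> b; apply: (@mulIf _ (mvn_pdf (- (C *m sv)) C 0)); first by rewrite gt_eqF.
rewrite [RHS]mulrAC divfK ?gt_eqF//.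
have qE x : qform (invmx C) (x - - (C *m sv)) =
    qform (cond_prec z y a) x + 2 * (x^T *m sv) 0 0 + (sv^T *m C *m sv) 0 0.
  by rewrite opprK invmxK qform_complete_square.
have [g gE] := joint_densityE z y a; rewrite !gE// /mvn_pdf -!/(qform _ _) !qE.
rewrite [LHS]mulrACA [RHS]mulrACA -!expRD -/sv; congr (_ * expR _).
by field.
Qed.

Lemma joint_density_gamma z y a b : posdef a ->
  exists2 h, 0 <= h & forall v, joint_density z y a b v =
    h * gamma_pdf (n%:R / 2 + 1) (cond_rate y / 2) v.
Proof.
move=> ap; have a1 : 1 <= n%:R / 2 + 1 :> R by rewrite lerDr divr_ge0.
have c0 : 0 < cond_rate y / 2 by rewrite divr_gt0// cond_rate_gt0.
pose k := (cond_rate y / 2) `^ (n%:R / 2 + 1) / gamma_fun (n%:R / 2 + 1).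
have k0 : 0 < k by rewrite divr_gt0 ?powR_gt0 ?gamma_fun_gt0.
have pdfE v : 0 < v -> gamma_pdf (n%:R / 2 + 1) (cond_rate y / 2) v =
    k * (Num.sqrt v ^+ n * expR (- (cond_rate y / 2 * v))).
  move=> v0'; rewrite /gamma_pdf v0' -/k addrK -mulrA.
  by rewrite -powR12_sqrt ?ltW// -powR_mulrn ?powR_ge0// -powRrM [2^-1 * _]mulrC.
have pdf1 : 0 < gamma_pdf (n%:R / 2 + 1) (cond_rate y / 2) 1.
  by rewrite pdfE// sqrtr1 expr1n mul1r mulr_gt0// expR_gt0.
(* The ratio at the reference point [v = 1]. For [v <= 0] both densities vanish, so the
   proportionality extends to all real [v]. *)
exists (joint_density z y a b 1 / gamma_pdf (n%:R / 2 + 1) (cond_rate y / 2) 1).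
  by rewrite divr_ge0 ?joint_density_ge0// ltW.
move=> v; have [v_gt0'|v_le0] := ltP 0 v; last first.
  rewrite joint_density_eq0; last by move=> [_]; rewrite ltNge v_le0.
  by rewrite /gamma_pdf (ltNge 0 v) v_le0 mulr0.
apply: (@mulIf _ (gamma_pdf (n%:R / 2 + 1) (cond_rate y / 2) 1)); first by rewrite gt_eqF.
rewrite [RHS]mulrAC divfK ?gt_eqF//.
have [g gE] := joint_densityE z y a; rewrite !gE// !pdfE//.
by ring.
Qed.

End spike_slab_density.

(** * The joint law on the slices Z = z *)

Section law_of_model.
Local Open Scope ereal_scope.
Context {R : realType} {d} {T : measurableType d} (P : probability T R).
Variables (v0 v1 lambda prob : R).
Hypotheses (v0_gt0 : (0 < v0)%R) (v1_gt0 : (0 < v1)%R)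
  (lambda_gt0 : (0 < lambda)%R) (prob_gt0 : (0 < prob)%R) (prob_lt1 : (prob < 1)%R).

Lemma prior_const_ge0 p (z : 'C(p, 2).-tuple bool) :
  (0 <= prior_const v0 v1 lambda z)%R.
Proof.
by apply: fine_ge0; apply: integral_ge0 => A _; rewrite lee_fin prior_unnorm_ge0.
Qed.

Lemma indicator_pmf_ge0 p (z : 'C(p, 2).-tuple bool) :
  (0 <= indicator_pmf v0 v1 lambda prob z)%R.
Proof.
have H z' : (0 <= @indicator_unnorm _ v0 v1 lambda prob p z')%R.
  rewrite mulr_ge0 ?prior_const_ge0//; apply: prodr_ge0 => i _; apply: prodr_ge0 => j _.
  by rewrite mulr_ge0// exprn_ge0// ?subr_ge0 ltW.
by rewrite mulr_ge0// invr_ge0 sumr_ge0.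
Qed.

(** The factor of the joint density on [Z = z] that is free of [Omega] and [Y]. *)
Definition mixing_weight p (z : 'C(p, 2).-tuple bool) : R :=
  (indicator_pmf v0 v1 lambda prob z * (prior_const v0 v1 lambda z)^-1)%R.

Lemma mixing_weight_ge0 p (z : 'C(p, 2).-tuple bool) : (0 <= mixing_weight z)%R.
Proof. by rewrite mulr_ge0 ?invr_ge0 ?indicator_pmf_ge0 ?prior_const_ge0. Qed.

Lemma measurable_bool_tuple1 p (z : p.-tuple bool) : measurable [set z].
Proof.
rewrite (_ : [set z] = \bigcap_i ((@tnth _ bool ^~ i) @^-1` [set tnth z i])).
  apply: fin_bigcap_measurable => // i _; rewrite -[X in measurable X]setTI.
  exact: measurable_tnth.
apply/seteqP; split=> [_ -> //|t H]; apply: eq_from_tnth => i; exact: H.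
Qed.

Lemma ge0_integral_slices p (Z : T -> p.-tuple bool) (g : T -> \bar R) :
  measurable_fun [set: T] Z -> (forall t, 0 <= g t) -> measurable_fun [set: T] g ->
  \int[P]_t g t = \sum_(z : p.-tuple bool) \int[P]_(t in Z @^-1` [set z]) g t.
Proof.
move=> mZ g0 mg; have mS z : measurable (Z @^-1` [set z]).
  by rewrite -[X in measurable X]setTI; apply: mZ => //; exact: measurable_bool_tuple1.
have UT : \big[setU/set0]_(z : p.-tuple bool) (Z @^-1` [set z]) = setT.
  apply/seteqP; split=> // t _; rewrite -bigcup_seq; exists (Z t) => //=.
  exact: mem_index_enum.
rewrite -ge0_integral_bigsetU ?UT//.
- exact: index_enum_uniq.
- by move=> z1 z2 _ _ [t [/= <- <-]].
Qed.

Variables (n p : nat).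
Variables (Y : {RV P >-> 'M[R]_(n, p)}) (Omega : {RV P >-> 'M[R]_p})
  (Z : {RV P >-> 'C(p, 2).-tuple bool}).
Hypothesis model : spike_slab_model v0 v1 lambda prob Y Omega Z.

Let base := (lebesgue_tuple R 'C(p.+1, 2) \x lebesgue_tuple R (n * p)).

Let joint z (x : 'C(p.+1, 2).-tuple R * (n * p).-tuple R) : R :=
  (mixing_weight z * (prior_unnorm v0 v1 lambda z (sym_of_tuple x.1) *
    likelihood (sym_of_tuple x.1) (mx_of_tuple x.2)))%R.

Let joint_ge0 z x : (0 <= joint z x)%R.
Proof.
apply: mulr_ge0; first exact: mixing_weight_ge0.
by apply: mulr_ge0; [exact: prior_unnorm_ge0|exact: likelihood_ge0].
Qed.

Let mjoint z : measurable_fun [set: _] (joint z).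
Proof.
have m1 : measurable_fun [set: 'C(p.+1, 2).-tuple R * (n * p).-tuple R]
    (fun x => sym_of_tuple x.1).
  by apply: measurableT_comp => //; exact: measurable_sym_of_tuple.
have m2 : measurable_fun [set: 'C(p.+1, 2).-tuple R * (n * p).-tuple R]
    (fun x => mx_of_tuple x.2).
  by apply: measurableT_comp => //; exact: measurable_mx_of_tuple.
apply: measurable_funM => //; apply: measurable_funM.
  by refine (measurableT_comp (measurable_prior_unnorm _ _ _ _) m1).
exact: measurable_likelihood.
Qed.

Let h (x : 'C(p.+1, 2).-tuple R * (n * p).-tuple R) : 'M[R]_p * 'M[R]_(n, p) :=
  (sym_of_tuple x.1, mx_of_tuple x.2).

Let mh : measurable_fun [set: _] h.
Proof.
apply: measurable_fun_pair; apply: measurableT_comp => //.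
  exact: measurable_sym_of_tuple.
exact: measurable_mx_of_tuple.
Qed.

Let mS z : measurable (Z @^-1` [set z]).
Proof.
by rewrite -[X in measurable X]setTI; apply: measurable_funPT => //;
  exact: measurable_bool_tuple1.
Qed.

(** The model prescribes iterated integrals; Tonelli makes them one integral over the product space,
    so that they become values of a measure with a density. *)
Let rectangle z B D : measurable B -> measurable D ->
  \int[base]_(x in h @^-1` (B `*` D)) (joint z x)%:E =
  P (Z @^-1` [set z] `&` Omega @^-1` B `&` Y @^-1` D).
Proof.
move=> mB mD; rewrite model//.
have mlik A : measurable_fun [set: 'M[R]_(n, p)] (fun y => (likelihood A y)%:E).
  by apply/measurable_EFinP; exact: measurable_likelihood.
have mlik2 : measurable_fun [set: 'M[R]_p * (n * p).-tuple R]
    (fun x => (likelihood x.1 (mx_of_tuple x.2))%:E).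
  apply/measurable_EFinP; apply: measurable_likelihood => //.
  by apply: measurableT_comp => //; exact: measurable_mx_of_tuple.
pose F (x : 'M[R]_p * (n * p).-tuple R) : \bar R :=
  (likelihood x.1 (mx_of_tuple x.2))%:E * (\1_D (mx_of_tuple x.2))%:E.
have mF : measurable_fun [set: _] F.
  apply: emeasurable_funM => //; apply/measurable_EFinP.
  refine (measurableT_comp (measurable_indic mD) _).
  by apply: measurableT_comp => //; exact: measurable_mx_of_tuple.
have F0 x : 0 <= F x by rewrite mule_ge0 ?lee_fin ?likelihood_ge0.
pose I A := \int[lebesgue_tuple R (n * p)]_y F (A, y).
have IE A : \int[lebesgue_mx R n p]_(y in D) (likelihood A y)%:E = I A.
  rewrite integral_mkcond ge0_integral_lebesgue_mx.
  - by apply: eq_integral => y _; rewrite epatch_indic.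
  - by move=> y; rewrite epatch_indic mule_ge0 ?lee_fin ?likelihood_ge0.
  - exact/(measurable_restrictT _ mD)/measurable_funTS.
have mI : measurable_fun [set: 'M[R]_p] I.
  exact: (measurable_fun_fubini_tonelli_F (m2 := lebesgue_tuple R (n * p)) F).
have I0 A : 0 <= I A by exact: integral_ge0.
pose c A : R := (prior_pdf v0 v1 lambda z A * \1_B A)%R.
have c0 A : (0 <= c A)%R.
  by rewrite mulr_ge0// mulr_ge0 ?invr_ge0 ?prior_const_ge0// prior_unnorm_ge0.
have mc : measurable_fun [set: 'M[R]_p] c.
  apply: measurable_funM; last exact: measurable_indic.
  by apply: measurable_funM => //; exact: measurable_prior_unnorm.
have -> : \int[lebesgue_sym R p]_(A in B) ((prior_pdf v0 v1 lambda z A)%:E *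
      \int[lebesgue_mx R n p]_(y in D) (likelihood A y)%:E) =
    \int[lebesgue_sym R p]_A ((c A)%:E * I A).
  rewrite integral_mkcond; apply: eq_integral => A _.
  by rewrite epatch_indic IE /c EFinM muleAC.
have cI0 A : 0 <= (c A)%:E * I A by rewrite mule_ge0 ?lee_fin.
have mcI : measurable_fun [set: 'M[R]_p] (fun A => (c A)%:E * I A).
  by apply: emeasurable_funM => //; exact/measurable_EFinP.
have mBD : measurable (h @^-1` (B `*` D)).
  by rewrite -[X in measurable X]setTI; apply: mh => //; exact: measurableX.
rewrite ge0_integral_lebesgue_sym// integral_mkcond fubini_tonelli1; last 2 first.
- apply/(measurable_restrictT _ mBD)/measurable_funTS/measurable_EFinP.
  exact: mjoint.
- by move=> x; rewrite epatch_indic mule_ge0 ?lee_fin.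
rewrite -ge0_integralZl_EFin//; last 2 first.
- by apply: (measurableT_comp mcI); exact: measurable_sym_of_tuple.
- exact: indicator_pmf_ge0.
apply: eq_integral => t _; rewrite /fubini_F epatch_indic /I muleA -EFinM.
rewrite -ge0_integralZl_EFin//; last 2 first.
- exact: measurableT_comp.
- by rewrite mulr_ge0// indicator_pmf_ge0.
apply: eq_integral => y _; rewrite /F/= /c /joint/= !indicE.
have -> : ((t, y) \in h @^-1` (B `*` D)) = (sym_of_tuple t \in B) && (mx_of_tuple y \in D).
  by apply/idP/andP => [/set_mem[]|[/set_mem ? /set_mem ?]]; [split; exact/mem_set|exact/mem_set].
rewrite -!EFinM -mulnb natrM /mixing_weight /prior_pdf; congr _%:E.
by set w := (_^-1)%R; ring.
Qed.

Let model_weight_ge0 z A (y : 'M[R]_(n, p)) : 0 <= (mixing_weight z *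
  (prior_unnorm v0 v1 lambda z A * likelihood A y))%:E.
Proof.
rewrite lee_fin mulr_ge0 ?mixing_weight_ge0//.
by rewrite mulr_ge0 ?prior_unnorm_ge0 ?likelihood_ge0.
Qed.

Lemma measurable_model_integral z (phi : 'M[R]_p * 'M[R]_(n, p) -> \bar R) :
  (forall x, 0 <= phi x) -> measurable_fun [set: _] phi ->
  measurable_fun [set: 'M[R]_p] (fun A => \int[lebesgue_tuple R (n * p)]_y
    (phi (A, mx_of_tuple y) * (mixing_weight z *
      (prior_unnorm v0 v1 lambda z A * likelihood A (mx_of_tuple y)))%:E)).
Proof.
move=> phi0 mphi.
pose F (x : 'M[R]_p * (n * p).-tuple R) : \bar R := phi (x.1, mx_of_tuple x.2) *
  (mixing_weight z * (prior_unnorm v0 v1 lambda z x.1 *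
    likelihood x.1 (mx_of_tuple x.2)))%:E.
have F0 x : 0 <= F x.
  by rewrite mule_ge0// model_weight_ge0.
have mmx : measurable_fun [set: 'M[R]_p * (n * p).-tuple R] (fun x => mx_of_tuple x.2).
  by apply: measurableT_comp => //; exact: measurable_mx_of_tuple.
have mF : measurable_fun [set: _] F.
  apply: emeasurable_funM.
    by apply: measurableT_comp => //; exact: measurable_fun_pair.
  apply/measurable_EFinP; apply: measurable_funM => //; apply: measurable_funM.
    by refine (measurableT_comp (measurable_prior_unnorm _ _ _ _) _).
  exact: measurable_likelihood.
exact: (measurable_fun_fubini_tonelli_F (m2 := lebesgue_tuple R (n * p)) F).
Qed.

(** The model fixes probabilities of rectangles only. These form a generating family stable under
    intersection, so two finite measures agreeing there are equal, and so are their integrals of any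
    nonnegative measurable function. *)
Lemma ge0_integral_model z (phi : 'M[R]_p * 'M[R]_(n, p) -> \bar R) :
  (forall x, 0 <= phi x) -> measurable_fun [set: _] phi ->
  \int[P]_(t in Z @^-1` [set z]) phi (Omega t, Y t) =
  \int[lebesgue_sym R p]_A \int[lebesgue_tuple R (n * p)]_y
    (phi (A, mx_of_tuple y) * (mixing_weight z *
      (prior_unnorm v0 v1 lambda z A * likelihood A (mx_of_tuple y)))%:E).
Proof.
move=> phi0 mphi; pose S := Z @^-1` [set z].
have S0 t : (0 <= \1_S t :> R)%R by [].
have mS1 : measurable_fun [set: T] (\1_S : T -> R) by exact/measurable_indic/mS.
pose X t := (Omega t, Y t).
have mX : measurable_fun [set: T] X by exact: measurable_fun_pair.
(* [m1] is the law of [(Omega, Y)] restricted to the event [Z = z]; [m2] is the measure given by the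
   model density. *)
pose m1 : {measure set ('M[R]_p * 'M[R]_(n, p)) -> \bar R} :=
  measure_function_pushforward__canonical__measure_function_Measure
    (density_measure P S0 mS1) mX.
pose m2 : {measure set ('M[R]_p * 'M[R]_(n, p)) -> \bar R} :=
  measure_function_pushforward__canonical__measure_function_Measure
    (density_measure base (joint_ge0 z) (mjoint z)) mh.
have m1E A : measurable A -> m1 A = P (S `&` X @^-1` A).
  move=> mA; rewrite -[LHS]/(\int[P]_(t in X @^-1` A) (\1_S t)%:E).
  have mXA : measurable (X @^-1` A).
    by rewrite -[X in measurable X]setTI; exact: (mX measurableT A mA).
  by rewrite integral_indic//; exact: mS.
pose G : set (set ('M[R]_p * 'M[R]_(n, p))) :=
  [set C | exists2 A, measurable A & exists2 B, measurable B & A `*` B = C].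
have m12 A : measurable A -> m1 A = m2 A.
  apply: (measure_unique G (fun=> setT)).
  - by rewrite measurable_prod_measurableType.
  - move=> _ _ [A1 mA1 [B1 mB1 <-]] [A2 mA2 [B2 mB2 <-]].
    exists (A1 `&` A2); first exact: measurableI.
    by exists (B1 `&` B2); [exact: measurableI|rewrite setXI].
  - by move=> _; exists setT => //; exists setT => //; rewrite setXTT.
  - by rewrite bigcup_const.
  - move=> _ [A1 mA1 [B1 mB1 <-]]; rewrite m1E; last exact: measurableX.
    rewrite -[RHS]/(\int[base]_(x in h @^-1` (A1 `*` B1)) (joint z x)%:E).
    by rewrite rectangle// -setIA; congr (P (_ `&` _)); apply/seteqP; split.
  - move=> _; rewrite m1E//; apply: (le_lt_trans (probability_le1 _ _)) => //.
      by rewrite preimage_setT setIT; exact: mS.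
    exact: ltry.
transitivity (\int[m1]_x phi x).
  rewrite [RHS]ge0_integral_pushforward// preimage_setT.
  rewrite [RHS]ge0_integral_density_measure; last 2 first.
  - by move=> t /=.
  - exact: measurableT_comp.
  by rewrite [LHS]integral_mkcond; apply: eq_integral => t _; rewrite epatch_indic.
transitivity (\int[m2]_x phi x).
  by apply: eq_measure_integral => A mA _; exact: m12.
rewrite [LHS]ge0_integral_pushforward// preimage_setT.
rewrite [LHS]ge0_integral_density_measure; last 2 first.
- by move=> t /=.
- exact: measurableT_comp.
rewrite fubini_tonelli1; last 2 first.
- apply: emeasurable_funM; first exact: measurableT_comp.
  by apply/measurable_EFinP; exact: mjoint.
- by move=> x; rewrite mule_ge0 ?lee_fin//=.
rewrite [RHS]ge0_integral_lebesgue_sym//.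
- by move=> A; apply: integral_ge0 => y _; rewrite mule_ge0// model_weight_ge0.
- exact: measurable_model_integral.
Qed.

End law_of_model.

Section block_matrix_measurability.
Context {R : realType} {d} {T : measurableType d}.

Lemma measurable_scalar_mx n (f : T -> R) :
  measurable_fun [set: T] f -> measurable_fun [set: T] (fun t => (f t)%:M : 'M[R]_n).
Proof.
move=> mf; apply: measurable_fun_mx => i j; under eq_fun do rewrite mxE.
by case: (i == j); [exact: mf|exact: measurable_cst].
Qed.

Lemma measurable_block_mx m1 m2 n1 n2 (A : T -> 'M[R]_(m1, n1)) (B : T -> 'M[R]_(m1, n2))
    (C : T -> 'M[R]_(m2, n1)) (D : T -> 'M[R]_(m2, n2)) :
  measurable_fun [set: T] A -> measurable_fun [set: T] B ->
  measurable_fun [set: T] C -> measurable_fun [set: T] D ->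
  measurable_fun [set: T] (fun t => block_mx (A t) (B t) (C t) (D t)).
Proof. by move=> *; apply: measurable_col_mx; exact: measurable_row_mx. Qed.

(** Any set of Boolean tuples is a finite union of measurable singletons; thus no regularity is
    required of the way [C] depends on [Z]. *)
Lemma measurable_fun_bool_tuple d' (U : measurableType d') p (f : p.-tuple bool -> U) :
  measurable_fun [set: p.-tuple bool] f.
Proof.
move=> _ A mA; rewrite setTI (_ : f @^-1` A = \bigcup_(z in f @^-1` A) [set z]).
  by apply: fin_bigcup_measurable => // z _; exact: measurable_bool_tuple1.
by apply/seteqP; split=> [z Az|z [_ Az ->//]]; exists z.
Qed.

End block_matrix_measurability.

(** * The slice laws in the coordinates [(Y, Omega11, u, v)] *)

Section spike_slab_conditionals.
Local Open Scope ereal_scope.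
Context {R : realType} {d} {T : measurableType d} (P : probability T R).
Variables (v0 v1 lambda prob : R).
Hypotheses (v0_gt0 : (0 < v0)%R) (v1_gt0 : (0 < v1)%R)
  (lambda_gt0 : (0 < lambda)%R) (prob_gt0 : (0 < prob)%R) (prob_lt1 : (prob < 1)%R).
Variables (n m : nat).
Variables (Y : {RV P >-> 'M[R]_(n, m + 1)}) (Omega : {RV P >-> 'M[R]_(m + 1)})
  (Z : {RV P >-> 'C(m + 1, 2).-tuple bool}).
Hypothesis model : spike_slab_model v0 v1 lambda prob Y Omega Z.

Local Notation leb := (@lebesgue_measure R).
Local Notation lebA := (lebesgue_tuple R 'C(m.+1, 2)).
Local Notation lebB := (lebesgue_tuple R (m * 1)).
Local Notation lebY := (lebesgue_tuple R (n * (m + 1))).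
Local Notation joint := (joint_density v0 v1 lambda).
Local Notation weight := (mixing_weight v0 v1 lambda prob).

Lemma measurable_assemble d' (U : measurableType d') (a : U -> 'M[R]_m)
    (b : U -> 'cV[R]_m) (v : U -> R) :
  measurable_fun [set: U] a -> measurable_fun [set: U] b ->
  measurable_fun [set: U] v ->
  measurable_fun [set: U] (fun t => assemble (a t) (b t) (v t)).
Proof.
move=> ma mb mv; apply: measurable_block_mx => //; first exact: measurable_trmx.
apply: measurable_scalar_mx; apply: measurable_funD => //.
by apply: measurable_qform => //; exact: measurable_invmx.
Qed.

Lemma measurable_joint_density z d' (U : measurableType d') (y : U -> 'M[R]_(n, m + 1))
    (a : U -> 'M[R]_m) (b : U -> 'cV[R]_m) (v : U -> R) :
  measurable_fun [set: U] y -> measurable_fun [set: U] a ->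
  measurable_fun [set: U] b -> measurable_fun [set: U] v ->
  measurable_fun [set: U] (fun t => joint z (y t) (a t) (b t) (v t)).
Proof.
move=> my ma mb mv; have mA := measurable_assemble ma mb mv.
apply: measurable_funM; last exact: measurable_likelihood.
by refine (measurableT_comp (measurable_prior_unnorm _ _ _ _) mA).
Qed.

Let Om11 t : 'M[R]_m := ulsubmx (Omega t).
Let u t : 'cV[R]_m := ursubmx (Omega t).
Let v t : R := (drsubmx (Omega t) 0 0 - qform (invmx (Om11 t)) (u t))%R.

Lemma ge0_integral_model_block z
    (psi : 'M[R]_(n, m + 1) * 'M[R]_m * 'cV[R]_m * R -> \bar R) :
  (forall x, 0 <= psi x) -> measurable_fun [set: _] psi ->
  \int[P]_(t in Z @^-1` [set z]) psi (Y t, Om11 t, u t, v t) =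
  \int[lebA]_a \int[lebB]_b \int[leb]_x \int[lebY]_y
    (psi (mx_of_tuple y, sym_of_tuple a, mx_of_tuple b, x) *
     (weight z * joint z (mx_of_tuple y) (sym_of_tuple a) (mx_of_tuple b) x)%:E).
Proof.
move=> psi0 mpsi.
pose phi (x : 'M[R]_(m + 1) * 'M[R]_(n, m + 1)) := psi (x.2, ulsubmx x.1, ursubmx x.1,
  (drsubmx x.1 0 0 - qform (invmx (ulsubmx x.1)) (ursubmx x.1))%R).
have phi0 x : 0 <= phi x by exact: psi0.
have mul := @measurable_ulsubmx R _ _ m 1 m 1 _
  (@measurable_fst _ _ 'M[R]_(m + 1) 'M[R]_(n, m + 1)).
have mur := @measurable_ursubmx R _ _ m 1 m 1 _
  (@measurable_fst _ _ 'M[R]_(m + 1) 'M[R]_(n, m + 1)).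
have mdr := @measurable_drsubmx R _ _ m 1 m 1 _
  (@measurable_fst _ _ 'M[R]_(m + 1) 'M[R]_(n, m + 1)).
have mphi : measurable_fun [set: _] phi.
  refine (measurableT_comp mpsi _); apply: measurable_fun_pair; last first.
    apply: measurable_funB; first exact: measurable_mx_entry.
    by apply: measurable_qform => //; exact: measurable_invmx.
  by do 2 apply: measurable_fun_pair => //.
rewrite [LHS](ge0_integral_model lambda_gt0 prob_gt0 prob_lt1 model z phi0 mphi).
have F0 (A : 'M[R]_(m + 1)) : 0 <= \int[lebY]_y (phi (A, mx_of_tuple y) * (weight z *
    (prior_unnorm v0 v1 lambda z A * likelihood A (mx_of_tuple y)))%:E).
  apply: integral_ge0 => y _; rewrite mule_ge0// lee_fin.
  rewrite mulr_ge0 ?mixing_weight_ge0// mulr_ge0 ?prior_unnorm_ge0//.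
  exact: likelihood_ge0.
have mF := measurable_model_integral v0 v1 lambda_gt0 prob_gt0 prob_lt1 z phi0 mphi.
rewrite [LHS](ge0_integral_lebesgue_sym_block F0 mF).
apply: eq_integral => a _; apply: eq_integral => b _.
set A : R -> 'M[R]_(m + 1) := fun w =>
  block_mx (sym_of_tuple a) (mx_of_tuple b) (mx_of_tuple b)^T w%:M.
have mA : measurable_fun [set: R] A.
  by apply: measurable_block_mx => //; exact: measurable_scalar_mx.
have mFA := measurableT_comp mF mA.
(* The change of variables: for fixed [Omega11] and [u], the corner is [v] translated by the
   quadratic form, with Jacobian 1. *)
rewrite -[LHS](ge0_integral_shift (qform (invmx (sym_of_tuple a)) (mx_of_tuple b))
  (fun w => F0 (A w)) mFA).
apply: eq_integral => x _; apply: eq_integral => y _; congr (_ * _).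
by rewrite /phi/= block_mxKul block_mxKur block_mxKdr mxE eqxx mulr1n addrK.
Qed.

Let integrand z (psi : 'M[R]_(n, m + 1) * 'M[R]_m * 'cV[R]_m * R -> \bar R) y a b x :=
  psi (y, a, b, x) * (weight z * joint z y a b x)%:E.

Let integrand_ge0 z psi y a b x : (forall w, 0 <= psi w) -> 0 <= integrand z psi y a b x.
Proof.
by move=> psi0; rewrite mule_ge0// lee_fin mulr_ge0 ?mixing_weight_ge0 ?joint_density_ge0.
Qed.

Let measurable_integrand z psi d' (U : measurableType d') (y : U -> 'M[R]_(n, m + 1))
    (a : U -> 'M[R]_m) (b : U -> 'cV[R]_m) (x : U -> R) :
  measurable_fun [set: _] psi ->
  measurable_fun [set: U] y -> measurable_fun [set: U] a ->
  measurable_fun [set: U] b -> measurable_fun [set: U] x ->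
  measurable_fun [set: U] (fun t => integrand z psi (y t) (a t) (b t) (x t)).
Proof.
move=> mpsi my ma mb mx; apply: emeasurable_funM.
  refine (measurableT_comp mpsi _).
  by do 3 apply: measurable_fun_pair => //.
apply/measurable_EFinP; apply: measurable_funM => //.
exact: measurable_joint_density.
Qed.

(** Reduces an identity between expectations on a slice to one with [Y], [Omega11] and [v] frozen,
    leaving only the integral over [u]. *)
Lemma eq_integral_slice_offdiag z psi1 psi2 :
  (forall w, 0 <= psi1 w) -> measurable_fun [set: _] psi1 ->
  (forall w, 0 <= psi2 w) -> measurable_fun [set: _] psi2 ->
  (forall y a x, \int[lebB]_b integrand z psi1 y a (mx_of_tuple b) x =
                 \int[lebB]_b integrand z psi2 y a (mx_of_tuple b) x) ->
  \int[P]_(t in Z @^-1` [set z]) psi1 (Y t, Om11 t, u t, v t) =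
  \int[P]_(t in Z @^-1` [set z]) psi2 (Y t, Om11 t, u t, v t).
Proof.
move=> psi10 mpsi1 psi20 mpsi2 H; rewrite (ge0_integral_model_block z psi10 mpsi1)
  (ge0_integral_model_block z psi20 mpsi2).
apply: eq_integral => a _.
have swap psi : (forall w, 0 <= psi w) -> measurable_fun [set: _] psi ->
    \int[lebB]_b \int[leb]_x \int[lebY]_y
      integrand z psi (mx_of_tuple y) (sym_of_tuple a) (mx_of_tuple b) x =
    \int[leb]_x \int[lebY]_y \int[lebB]_b
      integrand z psi (mx_of_tuple y) (sym_of_tuple a) (mx_of_tuple b) x.
  move=> psi0 mpsi.
  pose G (w : (m * 1).-tuple R * measurableTypeR R * (n * (m + 1)).-tuple R) :=
    integrand z psi (mx_of_tuple w.2) (sym_of_tuple a) (mx_of_tuple w.1.1) w.1.2.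
  have G0 w : 0 <= G w by exact: integrand_ge0.
  have mY : measurable_fun [set: (m * 1).-tuple R * measurableTypeR R *
      (n * (m + 1)).-tuple R] (fun w => mx_of_tuple w.2 : 'M[R]_(n, m + 1)).
    by apply: measurableT_comp => //; exact: measurable_mx_of_tuple.
  have mB : measurable_fun [set: (m * 1).-tuple R * measurableTypeR R *
      (n * (m + 1)).-tuple R] (fun w => mx_of_tuple w.1.1 : 'cV[R]_m).
    apply: (@measurableT_comp _ _ _ _ _ _ (@mx_of_tuple R m 1)).
      exact: measurable_mx_of_tuple.
    exact: measurableT_comp.
  have mG : measurable_fun [set: _] G.
    by apply: measurable_integrand => //; exact: measurableT_comp.
  (* Two exchanges bring [b] innermost: past [x], with the integral over [y] kept as one function
     [H1], and then past [y] for each fixed [x]. *)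
  pose H1 (w : (m * 1).-tuple R * measurableTypeR R) := \int[lebY]_y G (w, y).
  have mH1 : measurable_fun [set: _] H1.
    exact: (measurable_fun_fubini_tonelli_F (m2 := lebY) G mG G0).
  have H10 w : 0 <= H1 w by exact: integral_ge0.
  rewrite [LHS](fubini_tonelli (m1 := lebB) (m2 := leb) H1 mH1 H10).
  apply: eq_integral => x _.
  pose G2 (w : (m * 1).-tuple R * (n * (m + 1)).-tuple R) := G (w.1, x, w.2).
  have G20 w : 0 <= G2 w by exact: G0.
  have mG2 : measurable_fun [set: _] G2.
    apply: (@measurableT_comp _ _ _ _ _ _ G) => //.
    by do 2 apply: measurable_fun_pair => //.
  exact: (fubini_tonelli (m1 := lebB) (m2 := lebY) G2 mG2 G20).
rewrite [LHS](swap _ psi10 mpsi1) [RHS](swap _ psi20 mpsi2).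
by apply: eq_integral => x _; apply: eq_integral => y _; exact: H.
Qed.

Lemma eq_integral_slice_schur z psi1 psi2 :
  (forall w, 0 <= psi1 w) -> measurable_fun [set: _] psi1 ->
  (forall w, 0 <= psi2 w) -> measurable_fun [set: _] psi2 ->
  (forall y a b, \int[leb]_x integrand z psi1 y a b x =
                 \int[leb]_x integrand z psi2 y a b x) ->
  \int[P]_(t in Z @^-1` [set z]) psi1 (Y t, Om11 t, u t, v t) =
  \int[P]_(t in Z @^-1` [set z]) psi2 (Y t, Om11 t, u t, v t).
Proof.
move=> psi10 mpsi1 psi20 mpsi2 H; rewrite (ge0_integral_model_block z psi10 mpsi1)
  (ge0_integral_model_block z psi20 mpsi2).
apply: eq_integral => a _; apply: eq_integral => b _.
have swap psi : (forall w, 0 <= psi w) -> measurable_fun [set: _] psi ->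
    \int[leb]_x \int[lebY]_y
      integrand z psi (mx_of_tuple y) (sym_of_tuple a) (mx_of_tuple b) x =
    \int[lebY]_y \int[leb]_x
      integrand z psi (mx_of_tuple y) (sym_of_tuple a) (mx_of_tuple b) x.
  move=> psi0 mpsi.
  pose G (x : measurableTypeR R * (n * (m + 1)).-tuple R) :=
    integrand z psi (mx_of_tuple x.2) (sym_of_tuple a) (mx_of_tuple b) x.1.
  have G0 x : 0 <= G x by exact: integrand_ge0.
  have mG : measurable_fun [set: _] G.
    apply: measurable_integrand => //.
    apply: (@measurableT_comp _ _ _ _ _ _ (@mx_of_tuple R n (m + 1))) => //.
    exact: measurable_mx_of_tuple.
  exact: (fubini_tonelli (m1 := leb) (m2 := lebY) G mG G0).
rewrite [LHS](swap _ psi10 mpsi1) [RHS](swap _ psi20 mpsi2); apply: eq_integral => y _; exact: H.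
Qed.

End spike_slab_conditionals.

(** * The conditional kernels *)

Section regular_from_slices.
Local Open Scope ereal_scope.
Context {R : realType} {d dU dW} {T : measurableType d} {U : measurableType dU}
  {W : measurableType dW} (P : probability T R).

(** [Z] takes finitely many values, so the defining identity of a conditional distribution can be
    checked on each event [Z = z] and summed. *)
Lemma regular_cond_dist_slices (X : T -> U) (G : T -> W) (K : R.-pker W ~> U)
    p (Z : T -> p.-tuple bool) :
  measurable_fun [set: T] X -> measurable_fun [set: T] G ->
  measurable_fun [set: T] Z ->
  (forall z A B, measurable A -> measurable B ->
    \int[P]_(t in Z @^-1` [set z]) ((\1_A (X t))%:E * (\1_B (G t))%:E) =
    \int[P]_(t in Z @^-1` [set z]) (K (G t) A * (\1_B (G t))%:E)) ->
  regular_cond_dist P X G K.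
Proof.
move=> mX mG mZ slices A B mA mB.
have mXA : measurable (X @^-1` A) by rewrite -[X in measurable X]setTI; exact: mX.
have mGB : measurable (G @^-1` B) by rewrite -[X in measurable X]setTI; exact: mG.
have mXi : measurable_fun [set: T] (fun t => (\1_A (X t) : R)%:E).
  by apply/measurable_EFinP; exact: (measurableT_comp (measurable_indic mA)).
have mGi : measurable_fun [set: T] (fun t => (\1_B (G t) : R)%:E).
  by apply/measurable_EFinP; exact: (measurableT_comp (measurable_indic mB)).
have mKG : measurable_fun [set: T] (fun t => K (G t) A).
  exact: (measurableT_comp (measurable_kernel K A mA)).
transitivity (\int[P]_t ((\1_A (X t))%:E * (\1_B (G t))%:E)).
  transitivity (\int[P]_t (\1_(X @^-1` A `&` G @^-1` B) t)%:E).
    by rewrite integral_indic ?setIT//; exact: measurableI.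
  by apply: eq_integral => t _; rewrite indicI EFinM.
transitivity (\int[P]_t (K (G t) A * (\1_B (G t))%:E)); last first.
  by rewrite [RHS]integral_mkcond; apply: eq_integral => t _; rewrite epatch_indic.
rewrite (ge0_integral_slices P mZ); last 2 first.
- by move=> t; rewrite mule_ge0 ?lee_fin.
- exact: emeasurable_funM.
rewrite [RHS](ge0_integral_slices P mZ); last 2 first.
- by move=> t; rewrite mule_ge0 ?lee_fin.
- exact: emeasurable_funM.
by apply: eq_bigr => z _; exact: slices.
Qed.

End regular_from_slices.

Section conditional_kernels.
Context {R : realType}.
Variables (v0 v1 lambda : R).
Hypotheses (v0_gt0 : 0 < v0) (v1_gt0 : 0 < v1) (lambda_gt0 : 0 < lambda).
Variables n m : nat.

Local Notation offdiag_given :=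
  ('M[R]_(n, m + 1) * 'C(m + 1, 2).-tuple bool * 'M[R]_m * R)%type.
Local Notation schur_given :=
  ('M[R]_(n, m + 1) * 'C(m + 1, 2).-tuple bool * 'M[R]_m * 'cV[R]_m)%type.

Definition cond_cov (y : 'M[R]_(n, m + 1)) z (a : 'M[R]_m) : 'M[R]_m :=
  invmx (cond_prec v0 v1 lambda z y a).

Definition cond_mean (y : 'M[R]_(n, m + 1)) z (a : 'M[R]_m) : 'cV[R]_m :=
  - (cond_cov y z a *m ursubmx (y^T *m y)).

Lemma measurable_cond_cov d (T : measurableType d) (y : T -> 'M[R]_(n, m + 1))
    (z : T -> 'C(m + 1, 2).-tuple bool) (a : T -> 'M[R]_m) :
  measurable_fun [set: T] y -> measurable_fun [set: T] z ->
  measurable_fun [set: T] a ->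
  measurable_fun [set: T] (fun t => cond_cov (y t) (z t) (a t)).
Proof.
move=> my mz ma; apply: measurable_invmx; apply: measurable_addmx.
  apply: measurable_scalemx; last exact: measurable_invmx.
  apply: measurable_funD => //; apply: measurable_mx_entry.
  apply: measurable_drsubmx; apply: measurable_mulmx => //.
  exact: measurable_trmx.
exact: (measurableT_comp (measurable_fun_bool_tuple
  (fun z => diag_mx (map_mx GRing.inv (ursubmx (Vmx v0 v1 z)))^T)) mz).
Qed.

(* Off the set where Omega11 is positive definite the formula of the theorem
   need not be a probability density; any fixed density will do there. *)
Definition offdiag_density (x : offdiag_given * (m * 1).-tuple R) : R :=
  let: (y, z, a, _) := x.1 in
  if a \in @posdef R m then mvn_pdf (cond_mean y z a) (cond_cov y z a) (mx_of_tuple x.2)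
  else mvn_pdf 0 1%:M (mx_of_tuple x.2).

Lemma offdiag_density_ge0 x : 0 <= offdiag_density x.
Proof.
by case: x => -[[[y z] a] v] t; rewrite /offdiag_density/=; case: ifP => _;
  exact: mvn_pdf_ge0.
Qed.

Lemma measurable_offdiag_density : measurable_fun [set: _] offdiag_density.
Proof.
rewrite (_ : offdiag_density = fun x => if x.1.1.2 \in @posdef R m
  then mvn_pdf (cond_mean x.1.1.1.1 x.1.1.1.2 x.1.1.2)
    (cond_cov x.1.1.1.1 x.1.1.1.2 x.1.1.2) (mx_of_tuple x.2)
  else mvn_pdf 0 1%:M (mx_of_tuple x.2)); last first.
  by apply/funext => -[[[[y z] a] v] t].
have ma : measurable_fun [set: offdiag_given * (m * 1).-tuple R] (fun x => x.1.1.2).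
  by do 2 apply: measurableT_comp => //.
have mz : measurable_fun [set: offdiag_given * (m * 1).-tuple R] (fun x => x.1.1.1.2).
  by do 3 apply: measurableT_comp => //.
have my : measurable_fun [set: offdiag_given * (m * 1).-tuple R] (fun x => x.1.1.1.1).
  by do 3 apply: measurableT_comp => //.
have mt : measurable_fun [set: offdiag_given * (m * 1).-tuple R] (fun x => mx_of_tuple x.2).
  by apply: measurableT_comp => //; exact: measurable_mx_of_tuple.
have mC := measurable_cond_cov my mz ma.
apply: measurable_fun_ifT.
- apply: (measurable_fun_bool true); rewrite setTI.
  rewrite (_ : _ @^-1` _ = (fun x : offdiag_given * (m * 1).-tuple R => x.1.1.2)
    @^-1` @posdef R m).
    by rewrite -[X in measurable X]setTI; apply: ma => //; exact: measurable_posdef.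
  by apply/seteqP; split=> x /=; [exact: set_mem|exact: mem_set].
- apply: measurable_mvn_pdf => //; apply: measurable_oppmx.
  apply: measurable_mulmx => //; apply: measurable_ursubmx.
  by apply: measurable_mulmx => //; exact: measurable_trmx.
- exact: measurable_mvn_pdf.
Qed.

Lemma integral_offdiag_density w :
  (\int[lebesgue_tuple R (m * 1)]_t (offdiag_density (w, t))%:E = 1)%E.
Proof.
case: w => [[[y z] a] v]; rewrite /offdiag_density/=.
case: (boolP (a \in @posdef R m)) => [/set_mem ap|_]; apply: integral_mvn_pdf.
  by apply: posdef_invmx; exact: posdef_cond_prec.
rewrite -diag_const_mx; apply: posdef_diag_mx => i.
by rewrite mxE.
Qed.

Definition offdiag_kernel : R.-pker offdiag_given ~> 'cV[R]_m :=
  density_kernel (@measurable_mx_of_tuple R m 1)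
    offdiag_density_ge0 measurable_offdiag_density integral_offdiag_density.

Lemma integral_offdiag_kernel w A (c : R) : measurable A -> 0 <= c ->
  (\int[lebesgue_tuple R (m * 1)]_t
     ((\1_A (mx_of_tuple t))%:E * (c * offdiag_density (w, t))%:E) =
   \int[lebesgue_tuple R (m * 1)]_t
     (offdiag_kernel w A * (c * offdiag_density (w, t))%:E))%E.
Proof. exact: integral_density_kernel. Qed.

Definition schur_density (x : schur_given * R) : R :=
  gamma_pdf (n%:R / 2 + 1) (cond_rate lambda x.1.1.1.1 / 2) x.2.

Let shape_ge1 : 1 <= n%:R / 2 + 1 :> R.
Proof. by rewrite lerDr divr_ge0. Qed.

Lemma schur_density_ge0 x : 0 <= schur_density x.
Proof. exact: gamma_pdf_ge0. Qed.

Lemma measurable_schur_density : measurable_fun [set: _] schur_density.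
Proof.
have my : measurable_fun [set: schur_given * R] (fun x => x.1.1.1.1).
  by do 3 apply: measurableT_comp => //.
apply: measurable_gamma_pdf => //; apply: measurable_funM => //.
apply: measurable_funD => //; apply: measurable_mx_entry.
by apply: measurable_drsubmx; apply: measurable_mulmx => //; exact: measurable_trmx.
Qed.

Lemma integral_schur_density w :
  (\int[lebesgue_measure]_x (schur_density (w, x))%:E = 1)%E.
Proof.
have c0 : 0 < cond_rate lambda w.1.1.1 / 2 by rewrite divr_gt0// cond_rate_gt0.
exact: (integral_gamma_pdf shape_ge1 c0).
Qed.

(* [lebesgue_measure] lives on [measurableTypeR R], the theorem's [v] in [R]. *)
Let measurable_real_id :
  measurable_fun [set: measurableTypeR R] (fun x : measurableTypeR R => x : R).
Proof. exact: measurable_id. Qed.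

Definition schur_kernel : R.-pker schur_given ~> R :=
  density_kernel (nu := @lebesgue_measure R) measurable_real_id
    schur_density_ge0 measurable_schur_density integral_schur_density.

Lemma integral_schur_kernel w A (c : R) : measurable A -> 0 <= c ->
  (\int[lebesgue_measure]_x ((\1_A (x : R))%:E * (c * schur_density (w, x))%:E) =
   \int[lebesgue_measure]_x (schur_kernel w A * (c * schur_density (w, x))%:E))%E.
Proof. exact: integral_density_kernel. Qed.

End conditional_kernels.

(** * The two regular conditional distributions *)

Section conditional_slices.
Local Open Scope ereal_scope.
Context {R : realType} {d} {T : measurableType d} (P : probability T R).
Variables (v0 v1 lambda prob : R).
Hypotheses (v0_gt0 : (0 < v0)%R) (v1_gt0 : (0 < v1)%R)
  (lambda_gt0 : (0 < lambda)%R) (prob_gt0 : (0 < prob)%R) (prob_lt1 : (prob < 1)%R).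
Variables (n m : nat).
Variables (Y : {RV P >-> 'M[R]_(n, m + 1)}) (Omega : {RV P >-> 'M[R]_(m + 1)})
  (Z : {RV P >-> 'C(m + 1, 2).-tuple bool}).
Hypothesis model : spike_slab_model v0 v1 lambda prob Y Omega Z.

Local Notation offdiag_given :=
  ('M[R]_(n, m + 1) * 'C(m + 1, 2).-tuple bool * 'M[R]_m * R)%type.
Local Notation schur_given :=
  ('M[R]_(n, m + 1) * 'C(m + 1, 2).-tuple bool * 'M[R]_m * 'cV[R]_m)%type.
Local Notation Ku := (offdiag_kernel v0_gt0 v1_gt0 lambda_gt0 n m).
Local Notation Kv := (schur_kernel lambda_gt0 n m).

Lemma offdiag_kernelE y z a v A : posdef a -> measurable A ->
  Ku (y, z, a, v) A =
  mvn (cond_mean v0 v1 lambda y z a) (cond_cov v0 v1 lambda y z a) A.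
Proof.
move=> ap mA; rewrite [LHS]density_kernelE// mvnE//; apply: eq_integral => t _.
by rewrite /offdiag_density/= mem_set.
Qed.

Lemma schur_kernelE y z a b A : measurable A ->
  Kv (y, z, a, b) A = gamma_dist (n%:R / 2 + 1) (cond_rate lambda y / 2) A.
Proof. by move=> mA; rewrite [LHS]density_kernelE// gamma_distE. Qed.

Let Om11 t : 'M[R]_m := ulsubmx (Omega t).
Let u t : 'cV[R]_m := ursubmx (Omega t).
Let v t : R := (drsubmx (Omega t) 0 0 - qform (invmx (Om11 t)) (u t))%R.

Lemma measurable_leading_block : measurable_fun [set: T] Om11.
Proof. by apply: measurable_ulsubmx; exact: measurable_funPT. Qed.

Lemma measurable_offdiag_block : measurable_fun [set: T] u.
Proof. by apply: measurable_ursubmx; exact: measurable_funPT. Qed.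

Lemma measurable_schur_complement : measurable_fun [set: T] v.
Proof.
apply: measurable_funB.
  by apply: measurable_mx_entry; apply: measurable_drsubmx; exact: measurable_funPT.
apply: measurable_qform; last exact: measurable_offdiag_block.
by apply: measurable_invmx; exact: measurable_leading_block.
Qed.

Lemma regular_offdiag : regular_cond_dist P u (fun t => (Y t, Z t, Om11 t, v t)) Ku.
Proof.
have mZ : measurable_fun [set: T] Z by exact: measurable_funPT.
have mG : measurable_fun [set: T] (fun t => (Y t, Z t, Om11 t, v t)).
  apply: measurable_fun_pair; last exact: measurable_schur_complement.
  apply: measurable_fun_pair; last exact: measurable_leading_block.
  by apply: measurable_fun_pair; exact: measurable_funPT.
apply: (regular_cond_dist_slices measurable_offdiag_block mG mZ) => z A B mA mB.
pose W := ('M[R]_(n, m + 1) * 'M[R]_m * 'cV[R]_m * R)%type.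
(* On the slice, the conditioning tuple is a function of the continuous variables with [z]
   frozen. *)
pose g (w : W) : offdiag_given := (w.1.1.1, z, w.1.1.2, w.2).
have mg : measurable_fun [set: W] g.
  apply: measurable_fun_pair => //; apply: measurable_fun_pair; last first.
    by do 2 apply: measurableT_comp => //.
  apply: measurable_fun_pair => //.
  by do 2 apply: measurableT_comp => //.
pose psi1 (w : W) := (\1_A w.1.2 : R)%:E * (\1_B (g w) : R)%:E.
pose psi2 (w : W) := Ku (g w) A * (\1_B (g w) : R)%:E.
have psi10 w : 0 <= psi1 w by rewrite mule_ge0 ?lee_fin.
have psi20 w : 0 <= psi2 w by rewrite mule_ge0 ?lee_fin.
have mB1 : measurable_fun [set: W] (fun w => (\1_B (g w) : R)%:E).
  by apply/measurable_EFinP; exact: (measurableT_comp (measurable_indic mB)).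
have mpsi1 : measurable_fun [set: W] psi1.
  apply: emeasurable_funM => //; apply/measurable_EFinP.
  refine (measurableT_comp (measurable_indic mA) _).
  by apply: measurableT_comp => //.
have mpsi2 : measurable_fun [set: W] psi2.
  apply: emeasurable_funM => //.
  exact: (measurableT_comp (measurable_kernel Ku A mA) mg).
transitivity (\int[P]_(t in Z @^-1` [set z]) psi1 (Y t, Om11 t, u t, v t)).
  by apply: eq_integral => t /set_mem/= tz; rewrite /psi1 /g/= -tz.
transitivity (\int[P]_(t in Z @^-1` [set z]) psi2 (Y t, Om11 t, u t, v t)); last first.
  by apply: eq_integral => t /set_mem/= tz; rewrite /psi2 /g/= -tz.
apply: (eq_integral_slice_offdiag lambda_gt0 prob_gt0 prob_lt1 model psi10 mpsi1 psi20 mpsi2).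
(* Off the support the joint density vanishes for every [b] and both sides are zero; this also
   disposes of the values where the kernel uses its substitute density. *)
move=> y a x; have [[ap x0]|nax] := pselect (posdef a /\ (0 < x)%R); last first.
  by apply: eq_integral => b _; rewrite joint_density_eq0// mulr0 !mule0.
have [h h0 hE] := joint_density_mvn v0_gt0 v1_gt0 lambda_gt0 z y ap x0.
(* The event [B] concerns the conditioning variables only, so its indicator is constant in [b] and
   joins the other constants. *)
pose c : R := (mixing_weight v0 v1 lambda prob z * h * \1_B (y, z, a, x))%R.
have c0 : (0 <= c)%R by do 2 apply: mulr_ge0 => //; exact: mixing_weight_ge0.
have jE t : joint_density v0 v1 lambda z y a (mx_of_tuple t) x =
    (h * offdiag_density v0 v1 lambda (y, z, a, x, t))%R.
  by rewrite hE /offdiag_density/= mem_set.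
transitivity (\int[lebesgue_tuple R (m * 1)]_t
  ((\1_A (mx_of_tuple t))%:E * (c * offdiag_density v0 v1 lambda (y, z, a, x, t))%:E)).
  apply: eq_integral => t _; rewrite jE -!EFinM /c; congr _%:E => /=.
  by rewrite /g/=; ring.
rewrite [LHS](integral_offdiag_kernel v0_gt0 v1_gt0 lambda_gt0 (y, z, a, x) mA c0).
apply: eq_integral => t _; rewrite jE -muleA -EFinM; congr (_ * _%:E).
by rewrite /c /g/=; ring.
Qed.

Lemma regular_schur : regular_cond_dist P v (fun t => (Y t, Z t, Om11 t, u t)) Kv.
Proof.
have mZ : measurable_fun [set: T] Z by exact: measurable_funPT.
have mG : measurable_fun [set: T] (fun t => (Y t, Z t, Om11 t, u t)).
  apply: measurable_fun_pair; last exact: measurable_offdiag_block.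
  apply: measurable_fun_pair; last exact: measurable_leading_block.
  by apply: measurable_fun_pair; exact: measurable_funPT.
apply: (regular_cond_dist_slices measurable_schur_complement mG mZ) => z A B mA mB.
pose W := ('M[R]_(n, m + 1) * 'M[R]_m * 'cV[R]_m * R)%type.
pose g (w : W) : schur_given := (w.1.1.1, z, w.1.1.2, w.1.2).
have mg : measurable_fun [set: W] g.
  apply: measurable_fun_pair; last by apply: measurableT_comp => //.
  apply: measurable_fun_pair; last by do 2 apply: measurableT_comp => //.
  apply: measurable_fun_pair => //.
  by do 2 apply: measurableT_comp => //.
pose psi1 (w : W) := (\1_A w.2 : R)%:E * (\1_B (g w) : R)%:E.
pose psi2 (w : W) := Kv (g w) A * (\1_B (g w) : R)%:E.
have psi10 w : 0 <= psi1 w by rewrite mule_ge0 ?lee_fin.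
have psi20 w : 0 <= psi2 w by rewrite mule_ge0 ?lee_fin.
have mB1 : measurable_fun [set: W] (fun w => (\1_B (g w) : R)%:E).
  by apply/measurable_EFinP; exact: (measurableT_comp (measurable_indic mB)).
have mpsi1 : measurable_fun [set: W] psi1.
  apply: emeasurable_funM => //; apply/measurable_EFinP.
  by refine (measurableT_comp (measurable_indic mA) _).
have mpsi2 : measurable_fun [set: W] psi2.
  apply: emeasurable_funM => //.
  exact: (measurableT_comp (measurable_kernel Kv A mA) mg).
transitivity (\int[P]_(t in Z @^-1` [set z]) psi1 (Y t, Om11 t, u t, v t)).
  by apply: eq_integral => t /set_mem/= tz; rewrite /psi1 /g/= -tz.
transitivity (\int[P]_(t in Z @^-1` [set z]) psi2 (Y t, Om11 t, u t, v t)); last first.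
  by apply: eq_integral => t /set_mem/= tz; rewrite /psi2 /g/= -tz.
apply: (eq_integral_slice_schur lambda_gt0 prob_gt0 prob_lt1 model psi10 mpsi1 psi20 mpsi2).
(* No case on the sign of [x] here: it is the integration variable, and the Gamma identity already
   holds for all real values. *)
move=> y a b; have [ap|nap] := pselect (posdef a); last first.
  by apply: eq_integral => x _; rewrite joint_density_eq0 ?mulr0 ?mule0// => -[].
have [h h0 hE] := joint_density_gamma v0_gt0 v1_gt0 lambda_gt0 z y b ap.
pose c : R := (mixing_weight v0 v1 lambda prob z * h * \1_B (y, z, a, b))%R.
have c0 : (0 <= c)%R by do 2 apply: mulr_ge0 => //; exact: mixing_weight_ge0.
have jE x : joint_density v0 v1 lambda z y a b x =
    (h * schur_density lambda (y, z, a, b, x))%R by exact: hE.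
transitivity (\int[lebesgue_measure]_x
  ((\1_A (x : R))%:E * (c * schur_density lambda (y, z, a, b, x))%:E)).
  apply: eq_integral => x _; rewrite jE -!EFinM /c; congr _%:E => /=.
  by rewrite /g/=; ring.
rewrite [LHS](integral_schur_kernel lambda_gt0 (y, z, a, b) mA c0).
apply: eq_integral => x _; rewrite jE -muleA -EFinM; congr (_ * _%:E).
by rewrite /c /g/=; ring.
Qed.

(** The prior density carries the indicator of the cone, so each slice gives its complement
    probability zero. *)
Lemma ae_posdef : {ae P, forall t, posdef (Omega t)}.
Proof.
pose N := Omega @^-1` (~` @posdef R (m + 1)).
have mN : measurable N.
  rewrite -[X in measurable X]setTI; apply: measurable_funPT => //.
  by apply: measurableC; exact: measurable_posdef.
exists N; split=> //.
have mZ : measurable_fun [set: T] Z by exact: measurable_funPT.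
rewrite -[N]setIT -integral_indic// (ge0_integral_slices P mZ)//; last first.
  by apply/measurable_EFinP; exact: measurable_indic.
apply: big1 => z _.
have mS : measurable (Z @^-1` [set z]).
  by rewrite -[X in measurable X]setTI; apply: mZ => //; exact: measurable_bool_tuple1.
rewrite integral_indic//; transitivity (P (Z @^-1` [set z] `&`
    Omega @^-1` (~` @posdef R (m + 1)) `&` Y @^-1` setT)).
  by rewrite preimage_setT setIT setIC.
rewrite model//.
  rewrite integral0_eq ?mule0// => A nA.
  by rewrite /prior_pdf /prior_unnorm indicE memNset// !mulr0 mul0e.
by apply: measurableC; exact: measurable_posdef.
Qed.

End conditional_slices.

Theorem proposition1 (R : realType) (d : measure_display)
    (T : measurableType d) (P : probability T R) (n m : nat)
    (v0 v1 lambda prob : R)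
    (v0_gt0 : 0 < v0) (v1_gt0 : 0 < v1) (lambda_gt0 : 0 < lambda)
    (prob_gt0 : 0 < prob) (prob_lt1 : prob < 1)
    (Y : {RV P >-> 'M[R]_(n, m + 1)}) (Omega : {RV P >-> 'M[R]_(m + 1)})
    (Z : {RV P >-> 'C(m + 1, 2).-tuple bool})
    (model : spike_slab_model v0 v1 lambda prob Y Omega Z) :
  let S t : 'M[R]_(m + 1) := (Y t)^T *m Y t in
  let V t : 'M[R]_(m + 1) := Vmx v0 v1 (Z t) in
  let s12 t : 'cV[R]_m := ursubmx (S t) in
  let s22 t : R := drsubmx (S t) 0 0 in
  let v12 t : 'cV[R]_m := ursubmx (V t) in
  let Omega11 t : 'M[R]_m := ulsubmx (Omega t) in
  let u t : 'cV[R]_m := ursubmx (Omega t) in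
  let omega22 t : R := drsubmx (Omega t) 0 0 in
  let v t : R := omega22 t - ((u t)^T *m invmx (Omega11 t) *m u t) 0 0 in
  let C t : 'M[R]_m :=
    invmx ((s22 t + lambda) *: invmx (Omega11 t) +
           diag_mx (map_mx GRing.inv (v12 t))^T) in
  cond_distributed P u (fun t => (Y t, Z t, Omega11 t, v t))
    (fun t => mvn (- (C t *m s12 t)) (C t)) /\
  cond_distributed P v (fun t => (Y t, Z t, Omega11 t, u t))
    (fun t => gamma_dist (n%:R / 2 + 1) ((s22 t + lambda) / 2)).
Proof.
move=> S V s12 s22 v12 Omega11 u omega22 v C; split; split.
- exact: (@measurable_offdiag_block R d T P m Omega).
- apply: measurable_fun_pair; last exact: (@measurable_schur_complement R d T P m Omega).
  apply: measurable_fun_pair; last exact: (@measurable_leading_block R d T P m Omega).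
  by apply: measurable_fun_pair; exact: measurable_funPT.
- exists (offdiag_kernel v0_gt0 v1_gt0 lambda_gt0 n m).
    exact: (regular_offdiag v0_gt0 v1_gt0 lambda_gt0 prob_gt0 prob_lt1 model).
  (* The kernel coincides with the stated Gaussian law only where [Omega11] is positive definite,
     which holds almost surely. *)
  apply: filterS (ae_posdef model) => t Op A mA.
  rewrite offdiag_kernelE//; exact: posdef_ulsubmx.
- exact: (@measurable_schur_complement R d T P m Omega).
- apply: measurable_fun_pair; last exact: (@measurable_offdiag_block R d T P m Omega).
  apply: measurable_fun_pair; last exact: (@measurable_leading_block R d T P m Omega).
  by apply: measurable_fun_pair; exact: measurable_funPT.
- exists (schur_kernel lambda_gt0 n m).
    exact: (regular_schur v0_gt0 v1_gt0 lambda_gt0 prob_gt0 prob_lt1 model).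
  by apply: aeW => t A mA; rewrite schur_kernelE.
Qed.
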